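(* Let $X=\mathbb{C}^4$. Suppose that for every $N\ge1$ there is a choice of signs $o(\mathcal{L})$ such that, for $E=\bigoplus_{i=1}^N\mathcal{O}_X\langle y_i\rangle$ and $V=\bigoplus_{i=1}^N\mathcal{O}_X\langle v_i\rangle$, $$\mathcal{N}_X(E,V;q)=\operatorname{Exp}\left(\frac{[t_1t_2][t_2t_3][t_1t_3]}{[t_1][t_2][t_3][t_4]}\frac{[s]}{[s^{\frac12}q][s^{-\frac12}q]}\right),\qquad s=\prod_{i=1}^Ny_iv_i .$$ Then for every $r\ge0$, with $E=\bigoplus_{i=1}^{r+1}\mathcal{O}_X\langle y_i\rangle$ and $V=\bigoplus_{i=1}^r\mathcal{O}_X\langle v_i\rangle$, for some choice of signs, $$\mathcal{C}_X(E,V;q)=\exp\left(q\int_Xc_3(X)\right).$$ In particular, for $E=\bigoplus_{i=1}^N\mathcal{O}_X\langle y_i\rangle$ and some choice of signs, $$\sum_{n=0}^\infty q^n\sum_{Z\in\operatorname{Quot}_X(E,n)^{\mathsf{T}}}(-1)^{o(\mathcal{L})|_Z}\frac1{e_{\mathsf{T}}\left(\sqrt{T^{\mathrm{vir}}_Z}\right)}=\begin{cases}e^{\frac{(\lambda_1+\lambda_2)(\lambda_1+\lambda_3)(\lambda_2+\lambda_3)}{\lambda_1\lambda_2\lambda_3(\lambda_1+\lambda_2+\lambda_3)}q},&N=1,\\1,&\text{otherwise.}\end{cases}$$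
   Context: Setup. $\mathsf{T}=\mathsf{T}_0\times\mathsf{T}_1\times\mathsf{T}_2$, where $\mathsf{T}_0=\{t_1t_2t_3t_4=1\}\subset(\mathbb{C}^* )^4$ acts naturally on $X=\mathbb{C}^4$ with tangent weights $t_1,\dots,t_4$ at the origin, and $\mathsf{T}_1,\mathsf{T}_2$ are tori with coordinates $y_i,v_i$ acting trivially on $X$. $\lambda_i,m_i,w_i$ are the equivariant first Chern classes of $t_i,y_i,v_i$, with $\lambda_1+\lambda_2+\lambda_3+\lambda_4=0$; weights are identified with their Chern characters ($t_i=e^{\lambda_i}$, etc.). $\mathcal{O}_X\langle\chi\rangle$ is the trivial line bundle with character $\chi$. $c_3(X)=e_3(\lambda_1,\dots,\lambda_4)=-(\lambda_1+\lambda_2)(\lambda_1+\lambda_3)(\lambda_2+\lambda_3)$ and $\int_X\gamma=\gamma/(\lambda_1\lambda_2\lambda_3\lambda_4)$. $[x]=x^{1/2}-x^{-1/2}$. $\operatorname{Exp}(f)=\exp\big(\sum_{n\ge1}\frac1nf(q^n,t_i^n,y_i^n,v_i^n)\big)$ (half-powers $x^{1/2}$ going to $x^{n/2}$), the argument being expanded in powers of $q$. Fixed points. A solid partition is a finite set $\rho\subset\mathbb{Z}_{\ge0}^4$ closed under decreasing any coordinate (within $\mathbb{Z}_{\ge0}$). The $\mathsf{T}$-fixed points $Z_\pi$ of $\operatorname{Quot}_X(E,n)$ (zero-dimensional length $n$ quotients of $E=\bigoplus_{i=1}^N\mathcal{O}_X\langle y_i\rangle$) are indexed by $N$-tuples of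 solid partitions $\pi=(\pi^{(1)},\dots,\pi^{(N)})$ of total size $n$. Put $Q_k=\sum_{(a,b,c,d)\in\pi^{(k)}}t_1^{-a}t_2^{-b}t_3^{-c}t_4^{-d}$ and $$\sqrt{T^{\mathrm{vir}}_{Z_\pi}}=\sum_{k,l=1}^N\big(Q_l-(1-t_1)(1-t_2)(1-t_3)\overline{Q_k}Q_l\big)y_k^{-1}y_l$$ (bar inverts the $t_i$), a square root of the virtual tangent space $T^{\mathrm{vir}}_{Z_\pi}=\sqrt{T^{\mathrm{vir}}_{Z_\pi}}+\overline{\sqrt{T^{\mathrm{vir}}_{Z_\pi}}}$ (bar inverting all weights). For $V=\bigoplus_i\mathcal{O}_X\langle v_i\rangle$, $V^{[n]}|_{Z_\pi}=\sum_{i,k}v_iy_kQ_k$. A choice of signs $o(\mathcal{L})$ assigns a sign $(-1)^{o(\mathcal{L})|_Z}$ to each fixed point (induced by a choice of orientation of the determinant line bundle of the Quot scheme). Invariants. For a virtual character $\gamma=\sum n_\chi\chi$: $e_{\mathsf{T}}(\gamma)=\prod c_1(\chi)^{n_\chi}$, $c(\gamma)=\prod(1+c_1(\chi))^{n_\chi}$. Then $$\mathcal{C}_X(E,V;q)=\sum_{n\ge0}q^n\sum_Z(-1)^{o(\mathcal{L})|_Z}\frac{c(V^{[n]}|_Z)}{e_{\mathsf{T}}(\sqrt{T^{\mathrm{vir}}_Z})},$$ $$\mathcal{N}_X(E,V;q)=\sum_{n\ge0}q^n\sum_Z(-1)^{o(\mathcal{L})|_Z}\frac{\operatorname{ch}\big(\det(\sqrt{T^{\mathrm{vir}}_Z}^\vee)^{1/2}\big)}{\operatorname{ch}\big(\Lambda_{-1}\sqrt{T^{\mathrm{vir}}_Z}^\vee\big)}\operatorname{ch}\Big(\frac{\Lambda_{-1}V^{[n]}|_Z}{\det(V^{[n]}|_Z)^{1/2}}\Big),$$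 where $\Lambda_{-1}\gamma=\prod(1-\chi)^{n_\chi}$, $\gamma^\vee=\sum n_\chi\chi^{-1}$, $\det\gamma=\prod\chi^{n_\chi}$. *)

(* Defs.v *)
(* Mathematical Components, with multinomials ({mpoly _}, {freeg _}). *)
From mathcomp Require Import all_boot all_order all_algebra.
From mathcomp Require Import freeg mpoly.

Set Implicit Arguments.
Unset Strict Implicit.
Unset Printing Implicit Defensive.

Import GRing.Theory.
Local Open Scope ring_scope.

(** * Formal power series in q: [f : nat -> K] stands for sum_n (f n) q^n *)

Section PowerSeries.
Variable K : fieldType.
Implicit Types f g : nat -> K.

Definition pser_poly (p : {poly K}) : nat -> K := fun n => p`_n.
Definition pser_one : nat -> K := pser_poly 1.
Definition pser_mul f g : nat -> K := fun n => \sum_(i < n.+1) f i * g (n - i)%N.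
Definition pser_pow f k : nat -> K := iter k (pser_mul f) pser_one.

(* 1 / f = f_0^-1 * sum_k (1 - f / f_0)^k, for f_0 != 0: the terms k > n do not
   contribute to the coefficient of q^n. *)
Definition pser_inv f : nat -> K := fun n =>
  (f 0%N)^-1 *
  \sum_(k < n.+1) pser_pow (fun m => pser_one m - (f 0%N)^-1 * f m) k n.

(* For f_0 = 0 and K of characteristic 0; again the terms k > n vanish. *)
Definition pser_exp f : nat -> K := fun n =>
  \sum_(k < n.+1) (k`!%:R)^-1 * pser_pow f k n.

End PowerSeries.

(** * Rational functions and Adams operations *)

Definition ratfun (d : nat) := {fraction {mpoly rat[d]}}.

Definition ratfunX d (j : 'I_d) : ratfun d :=
  FracField.tofrac ('X_j : {mpoly rat[d]}).

(* The field endomorphism X_j |-> X_j ^ n, for n > 0; it does not depend on the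
   representative since the substitution is injective on polynomials. *)
Definition adams d (n : nat) (x : ratfun d) : ratfun d :=
  let subst (p : {mpoly rat[d]}) := p \mPo [tuple 'X_j ^+ n | j < d] in
  FracField.tofrac (subst \n_(repr x)) / FracField.tofrac (subst \d_(repr x)).

(* Exp(f) = exp (sum_(n >= 1) n^-1 f(q^n, X^n)), for f_0 = 0. *)
Definition pser_Exp d (f : nat -> ratfun d) : nat -> ratfun d :=
  pser_exp (fun m => \sum_(1 <= n < m.+1 | (n %| m)%N)
                       (n%:R)^-1 * adams n (f (m %/ n)%N)).

(** * Characters of T = T_0 x T_1 x T_2 *)

(* The character lattice, written additively, for E of rank N and V of rank r.
   Its basis is t_1, t_2, t_3, y_1, .., y_N, v_1, .., v_r. *)
Definition rkT (N r : nat) := (3 + (N + r))%N.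
Definition weight (N r : nat) := 'rV[int]_(rkT N r).

Section Characters.
Variables N r : nat.
Local Notation weight := (weight N r).
Local Notation K := (ratfun (rkT N r)).

(* [tw i] is t_(i+1), and t_4 = (t_1 t_2 t_3)^-1 on T_0. *)
Definition tw (i : 'I_4) : weight :=
  if unlift ord_max i is Some j then delta_mx 0 (lshift (N + r) j)
  else - \sum_(j < 3) delta_mx 0 (lshift (N + r) j).
Definition yw (k : 'I_N) : weight := delta_mx 0 (rshift 3 (lshift r k)).
Definition vw (i : 'I_r) : weight := delta_mx 0 (rshift 3 (rshift N i)).

(* In equivariant cohomology the indeterminates of K are the first Chern classes
   lambda_1, lambda_2, lambda_3, m_k, w_i of the basis. *)
Definition c1 (x : weight) : K := \sum_j (x 0 j)%:~R * ratfunX j.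

(* In equivariant K-theory characters are identified with their Chern characters
   and the indeterminates of K are the fourth roots of the basis: square roots
   of characters occur in the K-theoretic invariants, and s ^ (1/4) occurs in
   [s^(1/2) q]. Roots of characters are taken in the lattice tensored with Q, so
   that the chosen roots of t_1, .., t_4 multiply to 1. *)
Definition ch_quarter (x : weight) : K := \prod_j ratfunX j ^ (x 0 j).
Definition ch_half (x : weight) : K := ch_quarter (x *+ 2).
Definition ch (x : weight) : K := ch_quarter (x *+ 4).
Definition bracket (x : weight) : K := ch_half x - ch_half (- x).

(* Virtual characters are the elements of the group ring of the lattice, which
   has to be equipped with its convolution product. *)
Definition vchar := {freeg weight}.

Definition vwt (x : weight) : vchar := << x >>.
Definition vmul (g h : vchar) : vchar :=
  \sum_(x <- dom g) \sum_(z <- dom h) << coeff x g * coeff z h *g x + z >>.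
Definition vdual (g : vchar) : vchar :=
  \sum_(x <- dom g) << coeff x g *g - x >>.
Definition vdet (g : vchar) : weight := \sum_(x <- dom g) x *~ coeff x g.

Definition euler (g : vchar) : K := \prod_(x <- dom g) c1 x ^ coeff x g.
Definition chern (g : vchar) : K :=
  \prod_(x <- dom g) (1 + c1 x) ^ coeff x g.
Definition ch_Lambda (g : vchar) : K :=
  \prod_(x <- dom g) (1 - ch x) ^ coeff x g.

End Characters.

(** * Fixed points of Quot_X(E, n) *)

(* A solid partition with at most n boxes lies in {0, .., n-1}^4. *)
Definition box (n : nat) := {ffun 'I_4 -> 'I_n}.

Definition solid_partition n (rho : {set box n}) : bool :=
  [forall a in rho, forall b : box n, [forall i, (b i <= a i)%N] ==> (b \in rho)].

Definition box_tuple (N n : nat) := {ffun 'I_N -> {set box n}}.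

Definition fixed_point N n (p : box_tuple N n) : bool :=
  [forall k, solid_partition (p k)] && (\sum_k #|p k| == n)%N.

(* A sign (-1)^(o n p) for each fixed point p of Quot_X(E, n), for all n. *)
Definition signs (N : nat) := forall n, box_tuple N n -> bool.

(* [oriented N o] is meant to say that the signs o are induced by orientations
   of the Quot schemes Quot_X(E, n), rk E = N. The only property of orientations
   which is recorded is that the orientation of Quot_X(E, n) can be reversed,
   for each n independently; the class of all signs has this property too. *)
Definition reversible (oriented : forall N, signs N -> Prop) : Prop :=
  forall N (o : signs N) (e : nat -> bool),
    oriented N o -> oriented N (fun n p => e n (+) o n p).

(** * Invariants *)

Section Invariants.
Variables N r : nat.
Local Notation K := (ratfun (rkT N r)).
Local Notation vchar := (vchar N r).
Local Notation t := (tw N r).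
Local Notation vwt := (@vwt N r).
Local Infix "*v" := (@vmul N r) (at level 40, left associativity).

Section FixedPoint.
Variables (n : nat) (p : box_tuple N n).

Definition Qchar (k : 'I_N) : vchar :=
  \sum_(a in p k) vwt (- \sum_(i < 4) t i *+ a i).

Definition sqrt_Tvir : vchar :=
  \sum_(k < N) \sum_(l < N)
    (Qchar l - (vwt 0 - vwt (t 0)) *v (vwt 0 - vwt (t 1)) *v (vwt 0 - vwt (t 2))
               *v vdual (Qchar k) *v Qchar l)
    *v vwt (- yw r k) *v vwt (yw r l).

Definition taut : vchar :=
  \sum_(i < r) \sum_(k < N) vwt (vw N i) *v vwt (yw r k) *v Qchar k.

End FixedPoint.

Definition C_series (o : signs N) : nat -> K := fun n =>
  \sum_(p : box_tuple N n | fixed_point p)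
    (-1) ^+ o n p * (chern (taut p) / euler (sqrt_Tvir p)).

Definition N_series (o : signs N) : nat -> K := fun n =>
  \sum_(p : box_tuple N n | fixed_point p)
    (-1) ^+ o n p *
    (ch_half (vdet (vdual (sqrt_Tvir p))) / ch_Lambda (vdual (sqrt_Tvir p))) *
    (ch_Lambda (taut p) / ch_half (vdet (taut p))).

Definition lambda (i : 'I_4) : K := c1 (t i).

Definition c3X : K := (mesym 4 K 3).@[lambda].
Definition intX (g : K) : K := g / \prod_(i < 4) lambda i.

End Invariants.

(* The sum over fixed points of 1 / e_T(sqrt Tvir), without V. *)
Definition euler_series N (o : signs N) : nat -> ratfun (rkT N 0) := fun n =>
  \sum_(p : box_tuple N n | fixed_point p)
    (-1) ^+ o n p * (euler (sqrt_Tvir 0 p))^-1.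

Section Argument.
Variable N : nat.
Local Notation K := (ratfun (rkT N N)).
Local Notation t := (tw N N).

Definition sw : weight N N := \sum_(i < N) (yw N i + vw N i).

(* q^(1/2) [x^(1/2) q] = x^(1/4) q - x^(-1/4) *)
Definition qbracket (x : weight N N) : nat -> K :=
  pser_poly (ch_quarter x *: 'X - (ch_quarter (- x))%:P).

(* The expansion in powers of q of
     [t1 t2] [t2 t3] [t1 t3]              [s]
     ------------------------ * -------------------------- .
       [t1] [t2] [t3] [t4]      [s^(1/2) q] [s^(-1/2) q]    *)
Definition N_argument : nat -> K :=
  let A := bracket (t 0 + t 1) * bracket (t 1 + t 2) * bracket (t 0 + t 2)
           / \prod_(i < 4) bracket (t i) in
  pser_mul (pser_poly ((A * bracket sw) *: 'X))
           (pser_mul (pser_inv (qbracket sw)) (pser_inv (qbracket (- sw)))).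

End Argument.

(* Main.v *)
Require Import Defs.
From HB Require Import structures.
From mathcomp Require Import all_boot all_order all_algebra.
From mathcomp Require Import freeg mpoly.
From mathcomp Require Import generic_quotient ring zify.

(** The cohomological identity is a degeneration of the K-theoretic one. Let
    N > r >= 0. In the K-theoretic identity for E and V of rank N let the
    characters of T tend to 1, as 1 + b c_1 with b -> 0, except that the last
    N - r of the v_i are kept at a constant value; the first r of the w_i are
    moreover shifted by 1. The fixed-point term is the product of [x]^-1 over
    the weights x of the square root of the virtual tangent space and of -[x]
    over those of V^[n], and [x] = x^(1/2) - x^(-1/2) is b c_1(x) to first
    order. The tangent space has rank Nn, and the weights of V^[n] which tend
    to 1 are rn in number. Hence all terms of the coefficient of q^n have order
    b^((r - N) n), and the leading coefficients add up, up to a sign and a power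
    of a constant kappa, to the coefficient for V of rank r: the shift of the
    w_i turns Euler classes of V^[n] into total Chern classes
    ([asym_N_series]).

    On the other side, the argument of Exp is the product of
    [t_1 t_2] [t_2 t_3] [t_1 t_3] / ([t_1] [t_2] [t_3] [t_4]), which has a simple
    pole at b = 0, and of a power series in q without poles. Since the
    coefficient of q^m is rescaled by b^((N - r) m), the logarithm tends to 0
    for N - r >= 2 and to a multiple of q for N - r = 1, where only the
    coefficient of q contributes, and only to its first Adams operation
    ([asym_Exp_exponent]). The multiple is read off the residue of the pole,
    which is minus the integral of c_3(X) ([intX_c3X]).

    The case N = r + 1 yields the formula for the C-series, after reversing
    the orientation for some n. The sum of the inverse Euler classes is the case
    r = 0, where the condition N - r = 1 separates N = 1 from the other ranks.

    Limits are taken algebraically. A ring morphism from polynomials to the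
    field L(b) specializes those fractions whose denominator it does not kill,
    and elements of L(b) have orders and leading coefficients at b = 0; the
    relation [asym] combines the two steps. Uniqueness of leading coefficients
    ([asym_inj]) then converts one identity into the other. A weight equal
    to 0 annihilates the term of a fixed point in K-theory and in cohomology
    alike. *)

Set Implicit Arguments.
Unset Strict Implicit.
Unset Printing Implicit Defensive.

Import GRing.Theory Num.Theory.
Local Open Scope ring_scope.

Local Notation tofrac := (@FracField.tofrac _).

(** * Specialization of fractions along a ring morphism *)

Section Specialization.
Variables (R : idomainType) (F : fieldType) (phi : {rmorphism R -> F}).

(** The place of Frac R attached to phi, which is in general not injective: it is
defined on the fractions that have a denominator outside the kernel of phi. A
relation avoids choosing such a denominator. *)
Definition specializes (x : {fraction R}) (y : F) :=
  exists p q, [/\ phi q != 0, x = tofrac p / tofrac q & y = phi p / phi q].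

Lemma rmorph_neq0 q : phi q != 0 -> q != 0.
Proof. by apply: contraNneq => ->; rewrite rmorph0. Qed.

Lemma tofrac_neq0 q : phi q != 0 -> tofrac q != 0 :> {fraction R}.
Proof. by move/rmorph_neq0; rewrite tofrac_eq0. Qed.

Lemma specializes_inj x y z : specializes x y -> specializes x z -> y = z.
Proof.
move=> [p [q [q0 -> ->]]] [p' [q' [q'0 e ->]]].
have tq0 := tofrac_neq0 q0; have tq'0 := tofrac_neq0 q'0.
move/eqP: e; rewrite eqr_div // -!tofracM tofrac_eq => /eqP e.
by apply/eqP; rewrite eqr_div // -!rmorphM e.
Qed.

Lemma specializes_tofrac p : specializes (tofrac p) (phi p).
Proof.
by exists p, 1; rewrite !rmorph1 oner_neq0 !divr1.
Qed.

Lemma specializes0 : specializes 0 0.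
Proof. by have := specializes_tofrac 0; rewrite !rmorph0. Qed.

Lemma specializes1 : specializes 1 1.
Proof. by have := specializes_tofrac 1; rewrite !rmorph1. Qed.

Lemma specializesD x y a c :
  specializes x a -> specializes y c -> specializes (x + y) (a + c).
Proof.
move=> [p [q [q0 -> ->]]] [p' [q' [q'0 -> ->]]].
exists (p * q' + p' * q), (q * q').
by rewrite !(tofracD, tofracM, rmorphM, rmorphD) mulf_neq0 // !addf_div
  ?tofrac_neq0.
Qed.

Lemma specializesM x y a c :
  specializes x a -> specializes y c -> specializes (x * y) (a * c).
Proof.
move=> [p [q [q0 -> ->]]] [p' [q' [q'0 -> ->]]].
exists (p * p'), (q * q').
by rewrite !(tofracM, rmorphM) mulf_neq0 // !mulf_div.
Qed.

Lemma specializesN x a : specializes x a -> specializes (- x) (- a).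
Proof.
by move=> [p [q [q0 -> ->]]]; exists (- p), q; rewrite tofracN rmorphN !mulNr.
Qed.

Lemma specializesB x y a c :
  specializes x a -> specializes y c -> specializes (x - y) (a - c).
Proof. by move=> sx sy; apply/specializesD/specializesN. Qed.

(** The hypothesis on the value says exactly that the numerator may serve as a
denominator. *)
Lemma specializesV x a : a != 0 -> specializes x a -> specializes x^-1 a^-1.
Proof.
move=> a0 [p [q [q0 ex ea]]]; exists q, p.
rewrite ex ea !invf_div; split=> //.
by apply: contraNneq a0; rewrite ea => ->; rewrite mul0r.
Qed.

Lemma specializesXn x a n : specializes x a -> specializes (x ^+ n) (a ^+ n).
Proof.
move=> sx; elim: n => [|n IH]; first exact: specializes1.
by rewrite !exprS; apply: specializesM.
Qed.

Lemma specializesXz x a (k : int) :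
  a != 0 -> specializes x a -> specializes (x ^ k) (a ^ k).
Proof.
move=> a0 sx; case: k => n; first exact: specializesXn.
by apply: specializesV; rewrite ?expf_neq0 //; apply: specializesXn.
Qed.

Lemma specializes_prod I (s : seq I) (P : pred I) (x : I -> {fraction R}) a :
  (forall i, P i -> specializes (x i) (a i)) ->
  specializes (\prod_(i <- s | P i) x i) (\prod_(i <- s | P i) a i).
Proof.
move=> h; elim/big_rec2: _ => [|i y1 y2 Pi]; first exact: specializes1.
by apply: specializesM; apply: h.
Qed.

End Specialization.

(** * Leading terms at b = 0 *)

Lemma mul_increment (F : fieldType) (x y b : F) :
  (x * y - 1) / b = (x - 1) / b * y + (y - 1) / b.
Proof. by ring. Qed.

Lemma invr_increment (F : fieldType) (x b : F) : x != 0 -> b != 0 ->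
  (x^-1 - 1) / b = - ((x - 1) / b * x^-1).
Proof. by move=> x0 b0; field; rewrite x0 b0. Qed.

Section Limits.
Variable L : fieldType.
Local Notation M := {fraction {poly L}}.

(** The indeterminate b of M = L(b), whose limit is 0. *)
Definition infinitesimal : M := tofrac 'X.
Local Notation b := infinitesimal.

Definition lim0 (x : M) (a : L) := specializes (horner_eval (0 : L)) x a.

Lemma infinitesimal_neq0 : b != 0.
Proof. by rewrite tofrac_eq0 polyX_eq0. Qed.

Lemma lim0_poly (p : {poly L}) : lim0 (tofrac p) p.[0].
Proof. exact: (specializes_tofrac (horner_eval 0)). Qed.

Lemma lim0_b : lim0 b 0.
Proof. by have := lim0_poly 'X; rewrite hornerX. Qed.

(** x = 1 + a b + O(b^2). *)
Definition tangent (x : M) (a : L) := lim0 ((x - 1) / b) a.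

Lemma tangent_lim x a : tangent x a -> lim0 x 1.
Proof.
move=> tx; have := specializesD (specializesM tx lim0_b) (specializes1 _).
by rewrite divfK ?infinitesimal_neq0 // subrK mulr0 add0r.
Qed.

Lemma tangent1 : tangent 1 0.
Proof. by rewrite /tangent subrr mul0r; apply: specializes0. Qed.

(** Tangents turn products into sums: this is how Chern characters of weights
degenerate to first Chern classes. *)
Lemma tangentM x y a c : tangent x a -> tangent y c -> tangent (x * y) (a + c).
Proof.
move=> tx ty; rewrite -[a]mulr1 /tangent mul_increment.
exact: specializesD (specializesM tx (tangent_lim ty)) ty.
Qed.

Lemma tangentV x a : tangent x a -> tangent x^-1 (- a).
Proof.
move=> tx; have sx := tangent_lim tx.
have x0 : x != 0.
  apply/eqP => x0; have := specializes_inj sx; rewrite x0.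
  by move=> /(_ _ (specializes0 _))/eqP; rewrite oner_eq0.
rewrite /tangent (invr_increment x0 infinitesimal_neq0).
apply: specializesN; rewrite -[a]divr1; apply: specializesM tx _.
by apply: specializesV; rewrite ?oner_neq0.
Qed.

Lemma tangentXn x a n : tangent x a -> tangent (x ^+ n) (a *+ n).
Proof.
move=> tx; elim: n => [|n IH]; first exact: tangent1.
by rewrite exprS mulrS; apply: tangentM.
Qed.

Lemma tangentXz x a (k : int) : tangent x a -> tangent (x ^ k) (a *~ k).
Proof.
move=> tx; case: k => n; first exact: tangentXn.
exact/tangentV/tangentXn.
Qed.

Lemma tangent_prod I (s : seq I) (P : pred I) (x : I -> M) a :
  (forall i, P i -> tangent (x i) (a i)) ->
  tangent (\prod_(i <- s | P i) x i) (\sum_(i <- s | P i) a i).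
Proof.
move=> h; elim/big_rec2: _ => [|i y1 y2 Pi]; first exact: tangent1.
by apply: tangentM; apply: h.
Qed.

Lemma tangent_affine (z : L) : tangent (tofrac (1 + z *: 'X)) z.
Proof.
rewrite /tangent -tofrac1 -tofracB addrC addKr -mul_polyC tofracM mulfK
  ?infinitesimal_neq0 //.
by have := lim0_poly z%:P; rewrite hornerC.
Qed.

Section Asymptotics.
Variables (R : idomainType) (phi : {rmorphism R -> M}).

(** x specializes under phi to b^k (a + O(b)). The leading coefficient a may
vanish, so that an order k can be imposed on all the terms of a sum. *)
Definition asym (x : {fraction R}) (k : int) (a : L) :=
  exists2 y, specializes phi x y & lim0 (y / b ^ k) a.

Lemma asym_inj x k a c : asym x k a -> asym x k c -> a = c.
Proof.
move=> [y sy ly] [y' /(specializes_inj sy) <-]; exact: specializes_inj.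
Qed.

Lemma asym_eq x x' k k' a a' :
  asym x k a -> x = x' -> k = k' -> a = a' -> asym x' k' a'.
Proof. by move=> h <- <- <-. Qed.

Lemma asym_lim x y a : specializes phi x y -> lim0 y a -> asym x 0 a.
Proof. by exists y; rewrite // expr0z divr1. Qed.

Lemma asymM x x' k k' a a' :
  asym x k a -> asym x' k' a' -> asym (x * x') (k + k') (a * a').
Proof.
move=> [y sy ly] [y' sy' ly']; exists (y * y'); first exact: specializesM.
by rewrite expfzDr ?infinitesimal_neq0 // -mulf_div; apply: specializesM.
Qed.

Lemma asym0 k : asym 0 k 0.
Proof. by exists 0; [|rewrite mul0r]; apply: specializes0. Qed.

Lemma asym1 : asym 1 0 1.
Proof. by apply: asym_lim; exact: specializes1. Qed.

Lemma asymD x x' k a a' :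
  asym x k a -> asym x' k a' -> asym (x + x') k (a + a').
Proof.
move=> [y sy ly] [y' sy' ly']; exists (y + y'); first exact: specializesD.
by rewrite mulrDl; apply: specializesD.
Qed.

Lemma asymN x k a : asym x k a -> asym (- x) k (- a).
Proof.
move=> [y sy ly]; exists (- y); first exact: specializesN.
by rewrite mulNr; apply: specializesN.
Qed.

Lemma asymB x x' k a a' :
  asym x k a -> asym x' k a' -> asym (x - x') k (a - a').
Proof. by move=> sx sy; apply/asymD/asymN. Qed.

Lemma asymV x k a : a != 0 -> asym x k a -> asym x^-1 (- k) a^-1.
Proof.
move=> a0 [y sy ly]; exists y^-1.
  apply: specializesV sy; apply: contraNneq a0 => y0.
  apply/eqP; apply: specializes_inj ly _.
  by rewrite y0 mul0r; apply: specializes0.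
by rewrite -invr_expz -invfM; apply: specializesV.
Qed.

Lemma asym_div x x' k k' a a' : a' != 0 ->
  asym x k a -> asym x' k' a' -> asym (x / x') (k - k') (a / a').
Proof. by move=> a0 sx sx'; apply/asymM/asymV. Qed.

(** A positive power of b is left over, and it has limit 0. *)
Lemma asym_weaken x (k k' : int) a : k' < k -> asym x k a -> asym x k' 0.
Proof.
move=> lt [y sy ly]; exists y => //.
have [n en] : exists n, k - k' = n.+1%:Z by exists (absz (k - k' - 1)%R); lia.
have -> : y / b ^ k' = y / b ^ k * b ^+ n.+1.
  have -> : k = n.+1%:Z + k' by rewrite -en subrK.
  by rewrite expfzDr ?infinitesimal_neq0 // invfM mulrA mulrAC divfK
    ?expf_neq0 ?infinitesimal_neq0.
rewrite -(mulr0 a); apply: specializesM => //.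
rewrite exprS -[in X in specializes _ _ X](mul0r (0 ^+ n)).
by apply: specializesM; [|apply: specializesXn]; exact: lim0_b.
Qed.

Lemma asymXn x k a n : asym x k a -> asym (x ^+ n) (k *+ n) (a ^+ n).
Proof.
move=> sx; elim: n => [|n IH]; first exact: asym1.
by rewrite !exprS mulrS; apply: asymM.
Qed.

Lemma asymXz x k a (m : int) :
  a != 0 -> asym x k a -> asym (x ^ m) (k *~ m) (a ^ m).
Proof.
move=> a0 sx; case: m => n; first exact: asymXn.
by apply: asymV; rewrite ?expf_neq0 //; apply: asymXn.
Qed.

Lemma asym_prod I (s : seq I) (P : pred I) (x : I -> {fraction R}) k a :
  (forall i, P i -> asym (x i) (k i) (a i)) ->
  asym (\prod_(i <- s | P i) x i) (\sum_(i <- s | P i) k i)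
       (\prod_(i <- s | P i) a i).
Proof.
move=> h; elim/big_rec3: _ => [|i y1 y2 y3 Pi]; first exact: asym1.
by apply: asymM; apply: h.
Qed.

Lemma asym_sum I (s : seq I) (P : pred I) (x : I -> {fraction R}) k a :
  (forall i, P i -> asym (x i) k (a i)) ->
  asym (\sum_(i <- s | P i) x i) k (\sum_(i <- s | P i) a i).
Proof.
move=> h; elim/big_rec2: _ => [|i y1 y2 Pi]; first exact: asym0.
by apply: asymD; apply: h.
Qed.

Lemma asym_sum_small (I : eqType) (s : seq I) (P : pred I)
    (x : I -> {fraction R}) k :
  (forall i, i \in s -> P i -> asym (x i) k 0) ->
  asym (\sum_(i <- s | P i) x i) k 0.
Proof.
move=> h; rewrite big_seq_cond; apply: (big_ind (fun y => asym y k 0)).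
- exact: asym0.
- by move=> y z hy hz; rewrite -[0]addr0; apply: asymD.
- by move=> i /andP[si Pi]; apply: h.
Qed.

Lemma asym_nat n : asym n%:R 0 n%:R.
Proof.
elim: n => [|n IH]; first exact: asym0.
by rewrite -addn1 !natrD; apply: asymD => //; exact: asym1.
Qed.

End Asymptotics.
End Limits.

(** * Adams operations and specialization *)

(** Adams operations are defined on a chosen representative of x; this relates it
to the other presentations of x as a quotient. *)
Lemma frac_repr (R : idomainType) (x : {fraction R}) :
  x = tofrac \n_(repr x) / tofrac \d_(repr x).
Proof.
set n := \n_(repr x); set d := \d_(repr x).
have d0 : d != 0 by apply: denom_ratioP.
apply: (canRL (mulfK _)); rewrite ?tofrac_eq0 //.
rewrite -[x in LHS]reprK; unlock FracField.tofrac.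
rewrite -[LHS]FracField.pi_mul; apply/eqmodP.
rewrite /= FracField.equivfE /FracField.mulf.
rewrite !numden_Ratio ?mulf_neq0 ?oner_neq0 //.
by rewrite !mulr1 mulrC.
Qed.

Section Adams.
Variable d : nat.
Local Notation subst n := (comp_mpoly [tuple ('X_j : {mpoly rat[d]}) ^+ n | j < d]).

Lemma substX n (j : 'I_d) : subst n 'X_j = 'X_j ^+ n.
Proof. by rewrite comp_mpolyXU -tnth_nth tnth_mktuple. Qed.

(** X_j |-> X_j ^ n maps distinct monomials to distinct monomials. *)
Lemma subst_eq0 n (p : {mpoly rat[d]}) : (0 < n)%N -> (subst n p == 0) = (p == 0).
Proof.
move=> n0; apply/eqP/eqP => [|->]; last by rewrite rmorph0.
move=> p0; apply/mpolyP => m0; rewrite mcoeff0.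
have := congr1 (mcoeff (m0 *+ n)%MM) p0.
rewrite comp_mpolyEX mcoeff0 raddf_sum /=.
have e (m : 'X_{1..d}) : subst n 'X_[m] = 'X_[(m *+ n)%MM].
  rewrite comp_mpolyX.
  under eq_bigr => i _ do rewrite tnth_mktuple -exprM.
  rewrite [RHS]mpolyXE_id /=; apply: eq_bigr => i _.
  by rewrite mulmnE mulnC.
under eq_bigr => m _.
  rewrite mcoeffZ e mcoeffX.
  have -> : ((m *+ n)%MM == (m0 *+ n)%MM) = (m == m0).
    apply/eqP/eqP => [/mnmP h|-> //]; apply/mnmP => i.
    by move/eqP: (h i); rewrite !mulmnE eqn_pmul2r // => /eqP.
  over.
case: (boolP (m0 \in msupp p)) => [m0p|/memN_msupp_eq0 //].
rewrite (bigD1_seq m0) ?msupp_uniq //= eqxx mulr1 big1 ?addr0 //.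
by move=> m /negPf ->; rewrite mulr0.
Qed.

(** Specializing the n-th Adams operation of x amounts to specializing x along
the n-th powers of the values of the indeterminates. The result does not depend
on the representative of x because the substitution is injective. *)
Lemma specializes_adams (F : fieldType) (phi phin : {rmorphism {mpoly rat[d]} -> F})
    n (x : ratfun d) y : (0 < n)%N -> (forall p, phin p = phi (subst n p)) ->
  specializes phin x y -> specializes phi (adams n x) y.
Proof.
move=> n0 e [p [q [q0 ex ->]]].
exists (subst n p), (subst n q); rewrite -!e; split=> //.
rewrite /adams; have := frac_repr x.
set a := \n_(repr x); set c := \d_(repr x).
have c0 : c != 0 by apply: denom_ratioP.
rewrite ex; have q0' := rmorph_neq0 q0.
move/eqP; rewrite eqr_div ?tofrac_eq0 // -!tofracM tofrac_eq => /eqP E.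
apply/eqP; rewrite eqr_div ?tofrac_eq0 ?subst_eq0 // -!tofracM tofrac_eq.
by rewrite -!rmorphM E.
Qed.

End Adams.

(** * Characters in K-theory and in cohomology *)

Lemma intr_eq0_ratfun d (k : int) : ((k%:~R : ratfun d) == 0) = (k == 0).
Proof.
rewrite -(rmorph_int (FracField.tofrac (R := {mpoly rat[d]}))) tofrac_eq0.
rewrite -(rmorph_int (@mpolyC d rat)) mpolyC_eq0.
by rewrite intr_eq0.
Qed.

Lemma natr_eq0_ratfun d n : ((n%:R : ratfun d) == 0) = (n == 0)%N.
Proof. exact: (intr_eq0_ratfun d n). Qed.

(** Also true for a ^+ 2 = 1, when both sides are 0; this is what makes weights
equal to 0 harmless below. *)
Lemma invr_sub_invr (F : fieldType) (a : F) :
  a != 0 -> a^-1 / (1 - a^-1 ^+ 2) = (a - a^-1)^-1.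
Proof.
move=> a0; rewrite (_ : 1 - a^-1 ^+ 2 = a^-1 * (a - a^-1)).
  by rewrite invfM mulrA mulfV ?mul1r // invr_eq0.
by rewrite mulrBr mulVf // expr2.
Qed.

Lemma exprz_sum (F : fieldType) (a : F) I (s : seq I) (P : pred I) (k : I -> int) :
  a != 0 -> a ^ (\sum_(i <- s | P i) k i) = \prod_(i <- s | P i) a ^ k i.
Proof.
by move=> a0; apply: big_morph => // u v; rewrite expfzDr.
Qed.

(** The indices below n correspond to the basis of the smaller lattice, the others
to the v_i that it lacks. *)
Lemma big_widen (R : Type) (idx : R) (op : Monoid.com_law idx) n m
    (le_nm : (n <= m)%N) (F : 'I_m -> R) :
  \big[op/idx]_j F j =
  op (\big[op/idx]_(j < n) F (widen_ord le_nm j))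
     (\big[op/idx]_(j < m | (n <= j)%N) F j).
Proof.
rewrite (bigID (fun j : 'I_m => (n <= j)%N)) /= Monoid.mulmC.
congr (op _ _); under eq_bigl => j do rewrite -ltnNge.
exact: (big_ord_narrow le_nm).
Qed.

Section Lattice.
Variables N r : nat.
Local Notation K := (ratfun (rkT N r)).
Implicit Types x y : weight N r.

Lemma ratfunX_neq0 d (j : 'I_d) : ratfunX j != 0.
Proof.
rewrite /ratfunX tofrac_eq0; apply/eqP => /(congr1 (mcoeff U_(j)%MM)).
by rewrite mcoeffX eqxx mcoeff0 => /eqP; rewrite oner_eq0.
Qed.

Lemma ch_quarter0 : ch_quarter (0 : weight N r) = 1.
Proof. by rewrite /ch_quarter big1 // => j _; rewrite mxE. Qed.

Lemma ch_quarterD x y : ch_quarter (x + y) = ch_quarter x * ch_quarter y.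
Proof.
rewrite /ch_quarter -big_split; apply: eq_bigr => j _.
by rewrite mxE expfzDr ?ratfunX_neq0.
Qed.

Lemma ch_quarter_neq0 x : ch_quarter x != 0.
Proof.
by apply/prodf_neq0 => j _; rewrite expfz_neq0 ?ratfunX_neq0.
Qed.

Lemma ch_quarterN x : ch_quarter (- x) = (ch_quarter x)^-1.
Proof.
apply: (mulfI (ch_quarter_neq0 x)).
by rewrite -ch_quarterD subrr ch_quarter0 mulfV ?ch_quarter_neq0.
Qed.

Lemma ch_half_sqr x : ch x = ch_half x ^+ 2.
Proof. by rewrite /ch /ch_half -[4%N]/(2 + 2)%N mulrnDr ch_quarterD expr2. Qed.

Lemma ch_halfN x : ch_half (- x) = (ch_half x)^-1.
Proof. by rewrite /ch_half mulNrn ch_quarterN. Qed.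

Lemma ch_half_neq0 x : ch_half x != 0.
Proof. exact: ch_quarter_neq0. Qed.

(** A square root of the determinant symmetrizes the K-theoretic Euler class: each
weight contributes [x]^-1. *)
Lemma ch_half_bracket x : ch_half (- x) / (1 - ch (- x)) = (bracket x)^-1.
Proof.
by rewrite /bracket ch_half_sqr ch_halfN invr_sub_invr ?ch_half_neq0.
Qed.

Lemma bracket_ch_half x : (1 - ch x) / ch_half x = - bracket x.
Proof.
rewrite /bracket ch_half_sqr ch_halfN; set a := ch_half x.
have a0 : a != 0 by apply: ch_half_neq0.
by rewrite mulrBl mul1r expr2 mulfK // opprB.
Qed.

(** The lattice embeds in the polynomials of degree 1, as rat has
characteristic 0. *)
Lemma c1_eq0 x : (c1 x == 0) = (x == 0).
Proof.
have -> : c1 x = tofrac (\sum_j (x 0 j)%:~R *: 'X_j).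
  rewrite /c1 rmorph_sum; apply: eq_bigr => j _ /=.
  by rewrite -mul_mpolyC rmorphM !rmorph_int.
rewrite tofrac_eq0; apply/eqP/eqP => [|->]; last first.
  by rewrite big1 // => j _; rewrite mxE scale0r.
move=> e; apply/rowP => j; rewrite mxE.
have := congr1 (mcoeff U_(j)%MM) e; rewrite raddf_sum (bigD1 j) //=.
rewrite big1 => [|i ij]; last first.
  by rewrite mcoeffZ mcoeffX eq_mnm1 (negPf ij) mulr0.
rewrite mcoeffZ mcoeffX eqxx mulr1 addr0 mcoeff0 => /eqP.
by rewrite intr_eq0 => /eqP.
Qed.

Lemma c1D x y : c1 (x + y) = c1 x + c1 y.
Proof.
by rewrite /c1 -big_split; apply: eq_bigr => j _; rewrite mxE intrD mulrDl.
Qed.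

Lemma c1N x : c1 (- x) = - c1 x.
Proof.
by rewrite /c1 -sumrN; apply: eq_bigr => j _; rewrite mxE intrN mulNr.
Qed.

End Lattice.

(** * The curve along which the indeterminates degenerate *)

Lemma quarters (F : fieldType) (a : F) : (4 : F) != 0 ->
  (a + a) / 4 - (- a - a) / 4 = a.
Proof. by move=> h; field. Qed.

Section Substitution.
Variables N r : nat.
Hypothesis le_rN : (r <= N)%N.
Local Notation m := (rkT N N).
Local Notation L := (ratfun (rkT N r)).
Local Notation M := {fraction {poly L}}.

(** The unit added to the v_i turns first Chern classes into their values after
the shift w_i |-> w_i + 1, hence the Euler class of V^[n] into its total Chern
class. *)
Definition slope (j : 'I_(rkT N r)) : L := ratfunX j + (3 + N <= j)%N%:R.

(** The division by 4 accounts for the indeterminates being fourth roots of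
characters in K-theory. The v_i with i >= r stay at the constant 2, away from
the value 1 taken by the other indeterminates at b = 0: this is a stand-in for
w_i going to infinity. Any constant c with c <> 0 and c^4 <> 1 would do. *)
Definition curve (j : 'I_m) : {poly L} :=
  if insub (val j) is Some j' then 1 + (slope j' / 4) *: 'X else 2.

Definition curve_map : {rmorphism {mpoly rat[m]} -> M} :=
  mmap ((tofrac \o polyC) \o (tofrac \o @mpolyC _ _)) (tofrac \o curve).

Lemma curve_mapX j : curve_map 'X_j = tofrac (curve j).
Proof. by rewrite [LHS]mmapX mmap1U. Qed.

(** The total exponent of the v_i with i >= r, which stay at 2. *)
Definition surplus (y : weight N N) : int :=
  \sum_(j < m | (rkT N r <= j)%N) y 0 j.

(** The total exponent of the v_i; it is the coefficient of the shift in
[shifted_c1]. *)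
Definition vdegree (x : weight N r) : int :=
  \sum_(j < rkT N r | (3 + N <= j)%N) x 0 j.

(** The inclusion of the lattice with r weights v_i into the lattice with N of
them. As the v_i come last in the basis, it keeps indices unchanged. *)
Definition widen (x : weight N r) : weight N N :=
  \row_(j < m) oapp (x 0) 0 (insub (val j)).

Lemma le_rkT : (rkT N r <= m)%N.
Proof. by rewrite /rkT !leq_add2l. Qed.

Lemma widenE x (j : 'I_(rkT N r)) : widen x 0 (widen_ord le_rkT j) = x 0 j.
Proof. by rewrite mxE /= valK. Qed.

Lemma widen_out x (j : 'I_m) : (rkT N r <= j)%N -> widen x 0 j = 0.
Proof. by move=> le; rewrite mxE insubF //= ltnNge le. Qed.

Lemma curveE (j : 'I_(rkT N r)) :
  curve (widen_ord le_rkT j) = 1 + (slope j / 4) *: 'X.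
Proof. by rewrite /curve /= valK. Qed.

Lemma two_neq0 : 2 != 0 :> L.
Proof. by rewrite natr_eq0_ratfun. Qed.

Lemma curve0 (j : 'I_m) : (curve j).[0] = if (j < rkT N r)%N then 1 else 2.
Proof.
rewrite /curve; case: insubP => [j' lt _|/negPf ->]; last first.
  by rewrite -polyC_natr hornerC.
by rewrite lt hornerD hornerZ hornerX mulr0 addr0 hornerC.
Qed.

Lemma curve_neq0 j : curve j != 0.
Proof.
apply/eqP => /(congr1 (horner_eval 0)); rewrite /horner_eval curve0 horner0.
by case: ifP => _ /eqP; [rewrite oner_eq0|rewrite (negPf two_neq0)].
Qed.

Lemma widen_is_additive : zmod_morphism widen.
Proof.
move=> x y; apply/rowP => j; rewrite !mxE.
by case: insubP => [j' _ _|_] /=; rewrite ?subr0 ?mxE.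
Qed.
HB.instance Definition _ :=
  GRing.isZmodMorphism.Build _ _ widen widen_is_additive.

Lemma widen_inj : injective widen.
Proof. by move=> x y e; apply/rowP => j; rewrite -!widenE e. Qed.

Lemma vdegree_is_additive : zmod_morphism vdegree.
Proof.
by move=> x y; rewrite /vdegree -sumrB; apply: eq_bigr => j _; rewrite !mxE.
Qed.
HB.instance Definition _ :=
  GRing.isZmodMorphism.Build _ _ vdegree vdegree_is_additive.

Lemma surplus_is_additive : zmod_morphism surplus.
Proof.
by move=> x y; rewrite /surplus -sumrB; apply: eq_bigr => j _; rewrite !mxE.
Qed.
HB.instance Definition _ :=
  GRing.isZmodMorphism.Build _ _ surplus surplus_is_additive.

Definition shifted_c1 (x : weight N r) : L := c1 x + (vdegree x)%:~R.

Lemma shifted_c1D : {morph shifted_c1 : x y / x + y}.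
Proof. by move=> x y; rewrite /shifted_c1 c1D raddfD intrD addrACA. Qed.

Lemma shifted_c1N : {morph shifted_c1 : x / - x}.
Proof. by move=> x; rewrite /shifted_c1 c1N raddfN intrN opprD. Qed.

Section Power.
Variables (d : nat) (phi : {rmorphism {mpoly rat[m]} -> M}).
Hypothesis phiX : forall j, phi 'X_j = tofrac (curve j) ^+ d.
Local Notation asym := (asym phi).

Lemma specializes_quarter y : specializes phi (ch_quarter y)
  (\prod_j (tofrac (curve j) ^+ d) ^ y 0 j).
Proof.
apply: specializes_prod => j _; apply: specializesXz.
  by rewrite expf_neq0 ?tofrac_eq0 ?curve_neq0.
by rewrite -phiX; apply: specializes_tofrac.
Qed.

Lemma asym_quarter y : asym (ch_quarter y) 0 ((2 ^+ d) ^ surplus y).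
Proof.
apply: asym_lim; first exact: specializes_quarter.
have -> : ((2 : L) ^+ d) ^ surplus y = \prod_j ((curve j).[0] ^+ d) ^ y 0 j.
  rewrite (big_widen _ le_rkT) [X in _ = X * _]big1 => [|j _]; last first.
    by rewrite curve0 /= ltn_ord expr1n exp1rz.
  rewrite mul1r /surplus.
  rewrite exprz_sum ?expf_neq0 ?two_neq0 //.
  by apply: eq_bigr => j le; rewrite curve0 ltnNge le.
apply: specializes_prod => j _; apply: specializesXz.
  by rewrite curve0 expf_neq0 //; case: ifP => _; rewrite ?oner_neq0 ?two_neq0.
exact/specializesXn/lim0_poly.
Qed.

(** First-order expansion of a product of curves: the exponents become the
coefficients of the slopes. *)
Lemma asym_quarter1 x :
  asym (ch_quarter (widen x) - 1) 1 ((shifted_c1 x / 4) *+ d).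
Proof.
exists (\prod_j (tofrac (curve j) ^+ d) ^ widen x 0 j - 1).
  by apply: specializesB (specializes1 _); apply: specializes_quarter.
rewrite (big_widen _ le_rkT) [X in _ * X - 1]big1 => [|j le]; last first.
  by rewrite widen_out // expr0z.
rewrite mulr1 expr1z.
have -> : (shifted_c1 x / 4) *+ d = \sum_j ((slope j / 4) *+ d) *~ x 0 j.
  rewrite /shifted_c1 /c1 /vdegree.
  rewrite [\sum_(j < _ | (3 + N <= j)%N) _]big_mkcond /=.
  rewrite (rmorph_sum intr) -big_split /=.
  rewrite mulr_suml -sumrMnl; apply: eq_bigr => j _.
  rewrite /slope -[RHS]mulrzr [RHS]mulrnAl; congr (_ *+ d).
  rewrite [RHS]mulrAC [(ratfunX j + _) * _]mulrDl [ratfunX j * _]mulrC.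
  congr ((_ + _) / 4).
  by case: leqP => _; rewrite ?mul1r ?mul0r.
apply: tangent_prod => j _; rewrite widenE curveE.
exact/tangentXz/tangentXn/tangent_affine.
Qed.

(** [x] = x^(1/2) - x^(-1/2) vanishes to first order at b = 0. Along the d-th power
of the curve its derivative is d times the shifted first Chern class. *)
Lemma asym_bracket x :
  asym (bracket (widen x)) 1 (shifted_c1 x *+ d).
Proof.
rewrite /bracket /ch_half -raddfN -!raddfMn /=.
apply: asym_eq (asymB (asym_quarter1 (x *+ 2)) (asym_quarter1 (- x *+ 2)))
  _ erefl _.
  by rewrite opprB addrA subrK mulNrn.
rewrite !mulr2n -mulrnBl !shifted_c1D shifted_c1N.
by rewrite quarters ?natr_eq0_ratfun.
Qed.

(** The square root of y tends to 2^(2dk), so that [y] has a nonzero limit unless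
dk = 0. *)
Lemma asym_bracket_surplus y k : surplus y = k ->
  asym (bracket y) 0 ((2 ^+ d) ^ (k + k) - (2 ^+ d) ^ (- (k + k))).
Proof.
move=> <-; rewrite /bracket /ch_half !mulr2n -opprD.
rewrite -[surplus y + _]raddfD -[- surplus _]raddfN.
by apply: asymB; apply: asym_quarter.
Qed.

End Power.
End Substitution.

(** * Supports and products of virtual characters *)

Section Dom.
Variable A : choiceType.
Implicit Types (g h : {freeg A}) (P : pred A).

(** Operations on virtual characters change supports; iterating over a common
larger support makes the sums and products comparable. *)
Lemma big_dom (R : Type) (idx : R) (op : Monoid.com_law idx) g (s : seq A)
    (F : A -> R) : uniq s -> {subset dom g <= s} ->
    (forall x, coeff x g = 0 -> F x = idx) ->
  \big[op/idx]_(x <- dom g) F x = \big[op/idx]_(x <- s) F x.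
Proof.
move=> us sub F0.
have p : perm_eq (dom g) [seq x <- s | x \in dom g].
  apply: uniq_perm; rewrite ?uniq_dom ?filter_uniq // => x.
  by rewrite mem_filter; case: (boolP (x \in dom g)) => // /sub ->.
rewrite (perm_big _ p) big_filter big_mkcond; apply: eq_bigr => x _.
by case: ifP => // /negbT; rewrite mem_dom negbK => /eqP /F0.
Qed.

Lemma deg_dom g : deg g = \sum_(x <- dom g) coeff x g.
Proof.
rewrite -[in LHS](freeg_sumE g) raddf_sum /=.
by apply: eq_bigr => x _; rewrite degU.
Qed.

Definition supported (P : pred A) g := all P (dom g).

Lemma supportedP P g :
  reflect (forall x, coeff x g != 0 -> P x) (supported P g).
Proof.
apply: (iffP allP) => h x; first by rewrite -mem_dom; apply: h.
by rewrite mem_dom; apply: h.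
Qed.

Lemma supported0 P : supported P 0.
Proof. by apply/supportedP => x; rewrite coeff0 eqxx. Qed.

Lemma supportedD P g h : supported P g -> supported P h -> supported P (g + h).
Proof.
move=> /supportedP Pg /supportedP Ph; apply/supportedP => x; rewrite coeffD.
have [->|/Pg //] := eqVneq (coeff x g) 0.
by rewrite add0r => /Ph.
Qed.

Lemma supportedN P g : supported P g -> supported P (- g).
Proof.
by move=> /supportedP Pg; apply/supportedP => x; rewrite coeffN oppr_eq0 => /Pg.
Qed.

Lemma supportedB P g h : supported P g -> supported P h -> supported P (g - h).
Proof. by move=> Pg Ph; apply/supportedD/supportedN. Qed.

Lemma supportedU (P : pred A) k x : P x -> supported P << k *g x >>.
Proof.
move=> Px; apply/supportedP => y; rewrite coeffU.
by case: (eqVneq x y) => [<-|]; rewrite ?mulr0 ?eqxx.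
Qed.

Lemma supported_sum P I (s : seq I) (Q : pred I) (G : I -> {freeg A}) :
  (forall i, Q i -> supported P (G i)) -> supported P (\sum_(i <- s | Q i) G i).
Proof.
move=> h; apply: (big_ind (supported P)) => //; first exact: supported0.
exact: supportedD.
Qed.

(** For effective characters products over the weights are multiplicative for
every function f, even one that vanishes somewhere; with exponents of both signs
this would fail, since 0 ^ k * 0 ^ (- k) = 0 for k <> 0. *)
Definition effective g := forall x, 0 <= coeff x g.

Lemma effective0 : effective 0.
Proof. by move=> x; rewrite coeff0. Qed.

Lemma effectiveD g h : effective g -> effective h -> effective (g + h).
Proof. by move=> eg eh x; rewrite coeffD addr_ge0. Qed.

Lemma effectiveU x : effective << x >>.
Proof. by move=> y; rewrite coeffU mul1r; case: eqP. Qed.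

Lemma effective_sum I (s : seq I) (P : pred I) (G : I -> {freeg A}) :
  (forall i, P i -> effective (G i)) -> effective (\sum_(i <- s | P i) G i).
Proof.
by move=> eG; apply: (big_ind effective effective0 effectiveD).
Qed.

Section Product.
Variable F : fieldType.
Implicit Types f : A -> F.

Definition vprod f g := \prod_(x <- dom g) f x ^ coeff x g.

Lemma vprod_seq f g (s : seq A) : uniq s -> {subset dom g <= s} ->
  vprod f g = \prod_(x <- s) f x ^ coeff x g.
Proof. by move=> us sub; apply: big_dom => // x ->; rewrite expr0z. Qed.

Lemma eq_vprod f f' g : f =1 f' -> vprod f g = vprod f' g.
Proof. by move=> e; apply: eq_bigr => x _; rewrite e. Qed.

Lemma vprod0 f : vprod f 0 = 1.
Proof. by rewrite /vprod dom0 big_nil. Qed.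

Lemma vprodU f x : vprod f << x >> = f x.
Proof. by rewrite /vprod domU1 big_seq1 coeffU eqxx mulr1 expr1z. Qed.

Lemma vprodD f g h : effective g -> effective h ->
  vprod f (g + h) = vprod f g * vprod f h.
Proof.
move=> eg eh; pose s := undup (dom g ++ dom h).
have us : uniq s by apply: undup_uniq.
rewrite !(@vprod_seq f _ s) // -?big_split /=.
- apply: eq_bigr => x _; rewrite coeffD.
  case: (coeff x g) (eg x) => // k _; case: (coeff x h) (eh x) => // l _.
  exact: exprD.
- by move=> x; rewrite mem_undup mem_cat => ->; rewrite orbT.
- by move=> x; rewrite mem_undup mem_cat => ->.
- by move=> x /domD_subset; rewrite mem_undup.
Qed.

Lemma vprod_sum f I (s : seq I) (P : pred I) (G : I -> {freeg A}) :
    (forall i, P i -> effective (G i)) ->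
  vprod f (\sum_(i <- s | P i) G i) = \prod_(i <- s | P i) vprod f (G i).
Proof.
move=> eG; pose R g u := effective g /\ vprod f g = u.
suff [] : R (\sum_(i <- s | P i) G i) (\prod_(i <- s | P i) vprod f (G i)) by [].
apply: (big_ind2 R) => [|g u h v [eg <-] [eh <-]|i Pi].
- by split; [exact: effective0|exact: vprod0].
- by split; [exact: effectiveD|exact: vprodD].
- by split=> //; apply: eG.
Qed.

Lemma vprod_div f f' g :
  vprod f g / vprod f' g = vprod (fun x => f x / f' x) g.
Proof.
rewrite /vprod -prodfV -big_split; apply: eq_bigr => x _.
by rewrite /= expfzMl expfV.
Qed.

Lemma vprodV f g : vprod (fun x => (f x)^-1) g = (vprod f g)^-1.
Proof.
by rewrite /vprod -prodfV; apply: eq_bigr => x _; rewrite expfV.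
Qed.

(** With the convention 0^-1 = 0 a factor 0 annihilates the product, whatever the
sign of its exponent. *)
Lemma vprod_eq0 f g x : coeff x g != 0 -> f x = 0 -> vprod f g = 0.
Proof.
move=> gx fx; rewrite /vprod (bigD1_seq x) ?uniq_dom ?mem_dom //=.
by rewrite fx exp0rz (negPf gx) mul0r.
Qed.

End Product.
End Dom.

(** * Push-forward of virtual characters *)

Section Push.
Variables (A B : choiceType) (f : A -> B).
Implicit Types g h : {freeg A}.

Definition push g : {freeg B} := \sum_(x <- dom g) << coeff x g *g f x >>.

Lemma push_seq g (s : seq A) : uniq s -> {subset dom g <= s} ->
  push g = \sum_(x <- s) << coeff x g *g f x >>.
Proof. by move=> us sub; apply: big_dom => // x ->; rewrite freegU0. Qed.

Lemma push_is_additive : zmod_morphism push.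
Proof.
move=> g h; pose s := undup (dom g ++ dom h).
have us : uniq s by apply: undup_uniq.
rewrite !(@push_seq _ s) // -?sumrB /=.
- by apply: eq_bigr => x _; rewrite coeffB -freegUB.
- by move=> x; rewrite mem_undup mem_cat => ->; rewrite orbT.
- by move=> x; rewrite mem_undup mem_cat => ->.
- by move=> x /domB; rewrite mem_undup.
Qed.
HB.instance Definition _ :=
  GRing.isZmodMorphism.Build {freeg A} {freeg B} push push_is_additive.

Lemma pushU k x : push << k *g x >> = << k *g f x >>.
Proof.
rewrite (@push_seq _ [:: x]) // ?big_seq1 ?coeffU ?eqxx ?mulr1 // => y.
by rewrite mem_dom coeffU inE; case: (eqVneq x y) => [_|_] //; rewrite mulr0 eqxx.
Qed.

Hypothesis f_inj : injective f.

Lemma coeff_push g x : coeff (f x) (push g) = coeff x g.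
Proof.
rewrite -[in RHS](freeg_sumE g) !raddf_sum; apply: eq_bigr => y _ /=.
by rewrite !coeffU (inj_eq f_inj).
Qed.

Lemma dom_push g : perm_eq (dom (push g)) (map f (dom g)).
Proof.
apply: uniq_perm; rewrite ?uniq_dom ?(map_inj_uniq f_inj) ?uniq_dom // => y.
apply/idP/mapP => [|[x gx ->]]; last by rewrite mem_dom coeff_push -mem_dom.
rewrite mem_dom raddf_sum => /= y0.
have [x gx /eqP e] : exists2 x, x \in dom g & f x == y.
  apply/hasP; apply: contraNT y0 => /hasPn h; apply/eqP.
  rewrite big_seq big1 // => x gx; rewrite coeffU (negPf (h _ gx)) mulr0 //.
by exists x.
Qed.

Lemma big_dom_push (R : Type) (idx : R) (op : Monoid.com_law idx) g
    (F : B -> int -> R) :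
  \big[op/idx]_(y <- dom (push g)) F y (coeff y (push g)) =
  \big[op/idx]_(x <- dom g) F (f x) (coeff x g).
Proof.
rewrite (perm_big _ (dom_push g)) big_map; apply: eq_bigr => x _.
by rewrite coeff_push.
Qed.

Lemma vprod_push (F : fieldType) (c : B -> F) g :
  vprod c (push g) = vprod (c \o f) g.
Proof. exact: (big_dom_push _ _ (fun y k => c y ^ k)). Qed.

End Push.

Section GroupRing.
Variables N r : nat.
Implicit Types (g h : vchar N r) (x y : weight N r).

Lemma deg_vmul g h : deg (vmul g h) = deg g * deg h.
Proof.
rewrite raddf_sum [deg g]deg_dom mulr_suml; apply: eq_bigr => x _ /=.
rewrite raddf_sum [deg h]deg_dom mulr_sumr; apply: eq_bigr => y _ /=.
by rewrite degU.
Qed.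

Lemma vdual_push g : vdual g = push -%R g.
Proof. by []. Qed.

Lemma vmul_vwtl x h : vmul (vwt x) h = push (+%R x) h.
Proof.
rewrite /vmul /vwt domU1 big_seq1 coeffU eqxx mulr1.
by apply: eq_bigr => y _; rewrite mul1r.
Qed.

Lemma supported_vmul (P : pred (weight N r)) g h :
    (forall x y, P x -> P y -> P (x + y)) ->
  supported P g -> supported P h -> supported P (vmul g h).
Proof.
move=> PD /allP Pg /allP Ph; rewrite /vmul !big_seq.
apply: supported_sum => x gx; rewrite big_seq; apply: supported_sum => y hy.
by apply/supportedU/PD; [apply: Pg|apply: Ph].
Qed.

Lemma supported_push (P : pred (weight N r)) f g :
  (forall x, P x -> P (f x)) -> supported P g -> supported P (push f g).
Proof.
move=> Pf /allP Pg; rewrite /push big_seq.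
by apply: supported_sum => x gx; apply/supportedU/Pf/Pg.
Qed.

(** The determinant turns sums into products, so that its square root is again a
product over the weights. *)
Lemma ch_half_vdet g : ch_half (vdet g) = vprod (@ch_half N r) g.
Proof.
have D : {morph @ch_half N r : x y / x + y >-> x * y}.
  by move=> x y; rewrite /ch_half mulrnDl ch_quarterD.
have h0 : ch_half (0 : weight N r) = 1 by rewrite /ch_half mul0rn ch_quarter0.
rewrite /vdet (big_morph _ D h0); apply: eq_bigr => x _.
have Mn n : ch_half (x *+ n) = ch_half x ^+ n.
  by elim: n => [|n IH]; rewrite ?h0 // mulrS D IH exprS.
case: (coeff x g) => n; first exact: Mn.
by rewrite NegzE mulrNz ch_halfN -pmulrn Mn exprnN.
Qed.

End GroupRing.

Section PushMul.
Variables (N r N' r' : nat) (f : {additive weight N r -> weight N' r'}).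
Hypothesis f_inj : injective f.

(** An injective morphism of lattices induces a morphism of group rings;
injectivity ensures that coefficients are not merged. *)
Lemma push_vmul (g h : vchar N r) :
  push f (vmul g h) = vmul (push f g) (push f h).
Proof.
rewrite /vmul raddf_sum [RHS](big_dom_push f_inj _ _ (fun y k =>
   \sum_(z <- dom (push f h)) << k * coeff z (push f h) *g y + z >>)).
apply: eq_bigr => x _ /=; rewrite raddf_sum [RHS](big_dom_push f_inj _ _
   (fun z l => << coeff x g * l *g f x + z >>)).
by apply: eq_bigr => z _ /=; rewrite pushU raddfD.
Qed.

Lemma push_vdual (g : vchar N r) : push f (vdual g) = vdual (push f g).
Proof.
rewrite /vdual raddf_sum [RHS](big_dom_push f_inj _ _ (fun y k => << k *g - y >>)).
by apply: eq_bigr => x _ /=; rewrite pushU raddfN.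
Qed.

Lemma push_vwt x : push f (vwt x) = vwt (f x).
Proof. exact: pushU. Qed.

End PushMul.

(** * Fixed-point characters in the two lattices *)

Section FixedPoints.
Variables N r : nat.
Hypothesis le_rN : (r <= N)%N.
Local Notation widen := (@widen N r).
Variables (n : nat) (p : box_tuple N n).

Lemma widen_delta j :
  widen (delta_mx 0 j) = delta_mx 0 (widen_ord (le_rkT le_rN) j).
Proof.
apply/rowP => k; case: (ltnP k (rkT N r)) => [lt|le].
  have -> : k = widen_ord (le_rkT le_rN) (Ordinal lt) by apply: val_inj.
  by rewrite widenE !mxE.
rewrite widen_out // mxE /= -val_eqE /=.
by case: eqP => // e; move: le; rewrite e leqNgt ltn_ord.
Qed.

Lemma widen_tw i : widen (tw N r i) = tw N N i.
Proof.
have e j : widen (delta_mx 0 (lshift (N + r) j)) = delta_mx 0 (lshift (N + N) j).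
  by rewrite widen_delta; congr (delta_mx 0 _); apply: val_inj.
rewrite /tw; case: unlift => [j|]; first exact: e.
by rewrite raddfN raddf_sum; congr (- _); apply: eq_bigr => j _; apply: e.
Qed.

Lemma widen_yw k : widen (yw r k) = yw N k.
Proof.
by rewrite /yw widen_delta; congr (delta_mx 0 _); apply: val_inj.
Qed.

Lemma widen_vw i : widen (vw N i) = vw N (widen_ord le_rN i).
Proof.
by rewrite /vw widen_delta; congr (delta_mx 0 _); apply: val_inj.
Qed.

Lemma push_Qchar k : push widen (Qchar r p k) = Qchar N p k.
Proof.
rewrite raddf_sum; apply: eq_bigr => a _ /=; rewrite push_vwt raddfN raddf_sum.
by congr (vwt (- _)); apply: eq_bigr => i _; rewrite raddfMn /= widen_tw.
Qed.

Lemma push_sqrt_Tvir : push widen (sqrt_Tvir r p) = sqrt_Tvir N p.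
Proof.
have inj := widen_inj le_rN.
rewrite raddf_sum; apply: eq_bigr => k _.
rewrite raddf_sum; apply: eq_bigr => l _.
rewrite /= !(push_vmul inj) raddfB /= !(push_vmul inj) !raddfB /= !push_vwt.
by rewrite raddf0 raddfN /= !widen_tw !widen_yw push_vdual // !push_Qchar.
Qed.

Lemma deg_Qchar k : deg (Qchar r p k) = #|p k|%:Z.
Proof.
rewrite raddf_sum /=; under eq_bigr do rewrite degU.
by rewrite sumr_const natz.
Qed.

(** The factor (1 - t_1)(1 - t_2)(1 - t_3) has rank 0, so that only the Q_l
contribute, once for each k. *)
Lemma deg_sqrt_Tvir : fixed_point p -> deg (sqrt_Tvir r p) = (N * n)%:Z.
Proof.
case/andP => _ /eqP card_p.
rewrite raddf_sum /= (eq_bigr (fun=> n%:Z)) => [|k _].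
  by rewrite sumr_const card_ord PoszM -mulr_natl natz.
rewrite raddf_sum /= -[in RHS]card_p (rmorph_sum Posz); apply: eq_bigr => l _.
rewrite !deg_vmul raddfB /= !deg_vmul !raddfB /= !degU subrr !mul0r subr0 !mulr1.
exact: deg_Qchar.
Qed.

Lemma vdegree_delta (j : 'I_(rkT N r)) :
  vdegree (delta_mx 0 j) = (3 + N <= j)%N%:R.
Proof.
rewrite /vdegree big_mkcond (bigD1 j) //= big1 => [|i /negPf ij].
  by rewrite mxE !eqxx addr0 /=; case: leqP.
by rewrite mxE ij andbF; case: leqP.
Qed.

End FixedPoints.

Section Weights.
Variables N r : nat.
Hypothesis le_rN : (r <= N)%N.

Lemma vdegree_tw i : vdegree (tw N r i) = 0.
Proof.
have e j : vdegree (delta_mx 0 (lshift (N + r) j) : weight N r) = 0.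
  by rewrite vdegree_delta leqNgt /= ltn_addr ?ltn_ord.
rewrite /tw; case: unlift => [j|]; first exact: e.
rewrite (raddfN (@vdegree N r)) (raddf_sum (@vdegree N r)) big1 ?oppr0 //.
by move=> j _; apply: e.
Qed.

Lemma vdegree_sum_tw (a : 'I_4 -> nat) :
  vdegree (\sum_(j < 4) tw N r j *+ a j) = 0.
Proof.
rewrite (raddf_sum (@vdegree N r)) big1 // => j _.
by rewrite (raddfMn (@vdegree N r)) /= vdegree_tw mul0rn.
Qed.

Lemma vdegree_yw (k : 'I_N) : vdegree (yw r k) = 0.
Proof. by rewrite vdegree_delta /= leq_add2l leqNgt ltn_ord. Qed.

Lemma vdegree_vw (i : 'I_r) : vdegree (vw N i : weight N r) = 1.
Proof. by rewrite vdegree_delta /= leq_add2l leq_addr. Qed.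

Lemma surplus_widen (x : weight N r) : surplus r (widen x) = 0.
Proof. by rewrite /surplus big1 // => j; apply: widen_out. Qed.

Lemma surplus_vw (i : 'I_N) : surplus r (vw N i : weight N N) = (r <= i)%N%:R.
Proof.
rewrite /surplus big_mkcond (bigD1 (rshift 3 (rshift N i))) //=.
rewrite big1 => [|j /negPf h].
  by rewrite mxE !eqxx addr0 /= /rkT !leq_add2l; case: leqP.
by rewrite mxE h andbF; case: leqP.
Qed.

Lemma sum_ord_ge : \sum_(i < N | (r <= i)%N) 1%N = (N - r)%N.
Proof.
have := big_widen addn le_rN (fun=> 1%N).
rewrite !big_const_ord !iter_addn_0 !mul1n => e.
by apply: (@addnI r); rewrite subnKC.
Qed.

Lemma surplus_sw : surplus r (sw N) = (N - r)%:Z.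
Proof.
rewrite /sw raddf_sum /= (eq_bigr (fun i : 'I_N => (r <= i)%N : int)) => [|i _].
  rewrite -(rmorph_sum Posz) -big_mkcond /=.
  by rewrite sum_ord_ge.
rewrite raddfD /= surplus_vw -(widen_yw le_rN) surplus_widen add0r.
by case: leqP.
Qed.

Definition taut_weight n (i : 'I_r) (k : 'I_N) (a : box n) : weight N r :=
  vw N i + yw r k - \sum_(j < 4) tw N r j *+ a j.

Variables (n : nat) (p : box_tuple N n).

(** The tautological bundle is a genuine representation, with one weight for each
box and each pair of summands of V and E. *)
Lemma taut_sum : taut r p =
  \sum_(i < r) \sum_(k < N) \sum_(a in p k) << taut_weight i k a >>.
Proof.
apply: eq_bigr => i _; apply: eq_bigr => k _.
rewrite [vmul (vwt _) (vwt _)]vmul_vwtl [push _ (vwt _)]pushU vmul_vwtl raddf_sum.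
by apply: eq_bigr => a _; rewrite /= pushU.
Qed.

Lemma vprod_taut (F : fieldType) (f : weight N r -> F) :
  vprod f (taut r p) =
  \prod_(i < r) \prod_(k < N) \prod_(a in p k) f (taut_weight i k a).
Proof.
have e1 i k : effective (\sum_(a in p k) << taut_weight i k a >>).
  by apply: effective_sum => a _; apply: effectiveU.
have e2 i : effective (\sum_(k < N) \sum_(a in p k) << taut_weight i k a >>).
  by apply: effective_sum.
rewrite taut_sum vprod_sum //; apply: eq_bigr => i _.
rewrite vprod_sum //; apply: eq_bigr => k _.
rewrite vprod_sum => [|a _]; last exact: effectiveU.
by apply: eq_bigr => a _; rewrite vprodU.
Qed.

Lemma vdegree_taut_weight i k (a : box n) : vdegree (taut_weight i k a) = 1.
Proof.
rewrite (raddfB (@vdegree N r)) (raddfD (@vdegree N r)) /=.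
by rewrite vdegree_vw vdegree_yw vdegree_sum_tw subr0 addr0.
Qed.

Let vfree (x : weight N r) := vdegree x == 0.

Lemma supported_Qchar k : supported vfree (Qchar r p k).
Proof.
apply: supported_sum => a _; apply: supportedU.
by rewrite /vfree (raddfN (@vdegree N r)) /= vdegree_sum_tw oppr0.
Qed.

(** The tangent space involves no v_i. Hence its weights are not affected by the
shift, nor by the constant value of some v_i. *)
Lemma supported_sqrt_Tvir : supported vfree (sqrt_Tvir r p).
Proof.
have vfreeD x y : vfree x -> vfree y -> vfree (x + y).
  by rewrite /vfree (raddfD (@vdegree N r)) /= => /eqP -> /eqP ->.
have vfreeN x : vfree x -> vfree (- x).
  by rewrite /vfree (raddfN (@vdegree N r)) /= oppr_eq0.
have vfree0 : vfree 0 by rewrite /vfree (raddf0 (@vdegree N r)).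
have vfree_t i : vfree (tw N r i) by rewrite /vfree vdegree_tw.
have vfree_y k : vfree (yw r k) by rewrite /vfree vdegree_yw.
have unit_t i : supported vfree (vwt 0 - vwt (tw N r i)).
  by apply: supportedB; apply: supportedU.
apply: supported_sum => k _; apply: supported_sum => l _.
apply: supported_vmul => //; last exact: supportedU.
apply: supported_vmul => //; last exact/supportedU/vfreeN.
apply: supportedB; first exact: supported_Qchar.
apply: supported_vmul => //; last exact: supported_Qchar.
apply: supported_vmul => //; last by apply: supported_push (supported_Qchar k).
by do 2!apply: supported_vmul => //.
Qed.

End Weights.

Lemma prod_box_const (F : comNzRingType) N n (p : box_tuple N n) (c : F) :
  fixed_point p -> \prod_(k < N) \prod_(a in p k) c = c ^+ n.
Proof.
case/andP => _ /eqP e; rewrite -[in RHS]e.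
by rewrite -prodrXr; apply: eq_bigr => k _; rewrite prodr_const.
Qed.

Lemma sum_box_const N n (p : box_tuple N n) (c : int) :
  fixed_point p -> \sum_(k < N) \sum_(a in p k) c = c *+ n.
Proof.
case/andP => _ /eqP e; rewrite -[in RHS]e.
by rewrite -sumrMnr; apply: eq_bigr => k _; rewrite sumr_const.
Qed.

(** * Leading term of the K-theoretic series *)

Section Term.
Variables N r n : nat.
Hypothesis le_rN : (r <= N)%N.
Variable p : box_tuple N n.
Hypothesis fix_p : fixed_point p.

Definition N_term :=
  (ch_half (vdet (vdual (sqrt_Tvir N p))) / ch_Lambda (vdual (sqrt_Tvir N p))) *
  (ch_Lambda (taut N p) / ch_half (vdet (taut N p))).

Lemma N_termE : N_term =
  (vprod (@bracket N N) (sqrt_Tvir N p))^-1 *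
  vprod (fun x => - bracket x) (taut N p).
Proof.
rewrite /N_term !ch_half_vdet /ch_Lambda; congr (_ * _); last first.
  rewrite [LHS]vprod_div; apply: eq_vprod => x; exact: bracket_ch_half.
rewrite [LHS]vprod_div vdual_push vprod_push; last exact: oppr_inj.
by rewrite -vprodV; apply: eq_vprod => x; apply: ch_half_bracket.
Qed.

Local Notation L := (ratfun (rkT N r)).
Variable phi : {rmorphism {mpoly rat[rkT N N]} -> {fraction {poly L}}}.
Hypothesis phiX : forall j, phi 'X_j = tofrac (curve r j) ^+ 1.

(** The order is minus the rank of the square root of the tangent space. If 0 is
one of its weights, then the left-hand side and the leading coefficient are both
0. *)
Lemma asym_sqrt_Tvir : asym phi (vprod (@bracket N N) (sqrt_Tvir N p))^-1
  (- (N * n)%:Z) (euler (sqrt_Tvir r p))^-1.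
Proof.
rewrite -(push_sqrt_Tvir le_rN) vprod_push; last exact: widen_inj.
rewrite -(deg_sqrt_Tvir r fix_p) deg_dom.
set g := sqrt_Tvir r p.
(* A trivial weight makes both Euler classes vanish. *)
have [g0|g0] := eqVneq (coeff 0 g) 0; last first.
  have -> : euler g = 0.
    by apply: (vprod_eq0 g0); apply/eqP; rewrite c1_eq0.
  rewrite (vprod_eq0 g0) ?invr0; first exact: asym0.
  by rewrite /= raddf0 /bracket oppr0 subrr.
have x0 x : x \in dom g -> c1 x != 0.
  by rewrite c1_eq0 mem_dom; apply: contraNneq => ->; rewrite g0.
apply: asymV.
  by rewrite prodf_seq_neq0; apply/allP => x /x0 /= c0; rewrite expfz_neq0.
rewrite /vprod /euler !big_seq; apply: asym_prod => x gx.
have := asymXz (coeff x g) _ (asym_bracket le_rN phiX x).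
rewrite /shifted_c1 (eqP (allP (supported_sqrt_Tvir r p) _ gx)) addr0 mulr1n.
by move=> /(_ (x0 _ gx)); rewrite intz.
Qed.

End Term.

Lemma sqr_sub_invr_neq0 (F : fieldType) : (2 : F) != 0 -> (15%:R : F) != 0 ->
  2 ^+ 2 - 2 ^- 2 != 0 :> F.
Proof.
move=> h; apply: contraNneq => k0; have e : (4 : F) = 2 ^+ 2 by rewrite -natrX.
have : (2 ^+ 2 - 2 ^- 2) * 4 = 0 :> F by rewrite k0 mul0r.
rewrite mulrBl [in X in _ - X]e mulVf ?expf_neq0 // -natrX -natrM.
by rewrite -[X in _ - X]/(1%:R) -natrB // => ->.
Qed.

Section Taut.
Variables N r : nat.
Hypothesis le_rN : (r <= N)%N.
Local Notation L := (ratfun (rkT N r)).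
Variable phi : {rmorphism {mpoly rat[rkT N N]} -> {fraction {poly L}}}.
Hypothesis phiX : forall j, phi 'X_j = tofrac (curve r j) ^+ 1.

Lemma widen_taut_weight n (i : 'I_r) k (a : box n) :
  widen (taut_weight i k a) = taut_weight (widen_ord le_rN i) k a.
Proof.
rewrite raddfB raddfD /= (widen_vw le_rN) widen_yw // raddf_sum.
congr (_ - _); apply: eq_bigr => j _.
by rewrite raddfMn /= widen_tw.
Qed.

Lemma surplus_taut_weight n (i : 'I_N) k (a : box n) :
  (r <= i)%N -> surplus r (taut_weight i k a) = 1.
Proof.
move=> le; rewrite (raddfB (@surplus N r)) (raddfD (@surplus N r)) /= surplus_vw le.
rewrite -(widen_yw le_rN) surplus_widen.
rewrite (raddf_sum (@surplus N r)) big1 ?subr0 ?addr0 // => j _.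
by rewrite -(widen_tw le_rN) (raddfMn (@surplus N r)) /= surplus_widen mul0rn.
Qed.

(** The limit of [x] when x involves exactly one of the v_i with i >= r: the
quarter powers tend to 2. *)
Definition kappa : L := 2 ^+ 2 - 2 ^- 2.

Lemma kappa_neq0 : kappa != 0.
Proof.
by apply: sqr_sub_invr_neq0; rewrite natr_eq0_ratfun.
Qed.

Lemma asym_bracket_taut n (i : 'I_N) k (a : box n) : (r <= i)%N ->
  asym phi (bracket (taut_weight i k a)) 0 kappa.
Proof.
move=> le.
exact: (asym_bracket_surplus le_rN phiX (surplus_taut_weight k a le)).
Qed.

(** The v_i with i < r contribute (-1)^(rn) c(V^[n]), of order rn, where the shift
turns each first Chern class c_1 into 1 + c_1; the others tend to -kappa. *)
Lemma asym_taut n (p : box_tuple N n) : fixed_point p ->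
  asym phi (vprod (fun x => - bracket x) (taut N p)) (r * n)%:Z
    ((-1) ^+ (r * n) * chern (taut r p) * (- kappa) ^+ ((N - r) * n)).
Proof.
move=> fix_p; rewrite vprod_taut (big_widen _ le_rN) /=.
rewrite -[(r * n)%:Z]addr0; apply: asymM.
  have -> : (-1) ^+ (r * n) * chern (taut r p) =
     \prod_(i < r) \prod_(k < N) \prod_(a in p k) - (c1 (taut_weight i k a) + 1).
    rewrite /chern [X in _ * X]vprod_taut.
    have -> : ((-1) ^+ (r * n) : L) =
        \prod_(i < r) \prod_(k < N) \prod_(a in p k) (-1).
      under eq_bigr do rewrite prod_box_const //.
      by rewrite prodr_const card_ord -exprM mulnC.
    rewrite -big_split; apply: eq_bigr => i _; rewrite -big_split.
    apply: eq_bigr => k _; rewrite -big_split; apply: eq_bigr => a _.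
    by rewrite /= mulN1r addrC.
  have -> : (r * n)%:Z = \sum_(i < r) \sum_(k < N) \sum_(a in p k) 1.
    under eq_bigr do rewrite sum_box_const //.
    by rewrite sumr_const card_ord -mulrnA natz mulnC.
  apply: asym_prod => i _; apply: asym_prod => k _; apply: asym_prod => a _.
  apply: asymN; rewrite -widen_taut_weight.
  have := asym_bracket le_rN phiX (taut_weight i k a).
  by rewrite /shifted_c1 vdegree_taut_weight mulr1n.
have -> : (- kappa) ^+ ((N - r) * n) = \prod_(i < N | (r <= i)%N)
    \prod_(k < N) \prod_(a in p k) (- kappa).
  rewrite -(sum_ord_ge le_rN) big_distrl /= -prodrXr.
  by apply: eq_bigr => i _; rewrite mul1n prod_box_const.
have -> : (0 : int) = \sum_(i < N | (r <= i)%N) \sum_(k < N) \sum_(a in p k) 0.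
  by rewrite big1 // => i _; rewrite big1 // => k _; rewrite big1.
apply: asym_prod => i le; apply: asym_prod => k _; apply: asym_prod => a _.
exact/asymN/asym_bracket_taut.
Qed.

(** All fixed points contribute with the same order (r - N)n, whence a common
leading term: the C-series for V of rank r. *)
Lemma asym_N_series o n : asym phi (N_series N o n) ((r * n)%:Z - (N * n)%:Z)
  ((-1) ^+ (r * n) * (- kappa) ^+ ((N - r) * n) * C_series r o n).
Proof.
rewrite /C_series mulr_sumr; apply: asym_sum => p fix_p.
apply: asym_eq (asymM (asymXn (o n p) (asymN (asym1 phi)))
  (asymM (asym_taut fix_p) (asym_sqrt_Tvir le_rN fix_p phiX))) _ _ _.
- rewrite -mulrA -[X in _ = _ * X]/(N_term p) N_termE.
  by congr (_ * _); rewrite mulrC.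
- by rewrite mul0rn add0r.
- rewrite [RHS]mulrCA; congr (_ * _).
  by rewrite mulrA; congr (_ / _); rewrite mulrAC.
Qed.

End Taut.

(** * Power series and their leading terms *)

Section PowerSeries.
Variable K : fieldType.
Implicit Types (f g : nat -> K) (p : {poly K}).

Lemma pser_oneE n : pser_one K n = (n == 0%N)%:R.
Proof. exact: coef1. Qed.

Lemma eq_pser_mul f f' g g' : f =1 f' -> g =1 g' -> pser_mul f g =1 pser_mul f' g'.
Proof. by move=> ef eg n; apply: eq_bigr => i _; rewrite ef eg. Qed.

Lemma pser_pow_poly p k : pser_pow (pser_poly p) k =1 pser_poly (p ^+ k).
Proof.
elim: k => [|k IH] n; first by rewrite /pser_pow /= /pser_one expr0.
transitivity (pser_mul (pser_poly p) (pser_poly (p ^+ k)) n).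
  exact: eq_pser_mul.
by rewrite /pser_poly exprS coefM.
Qed.

(** Only the term k = n of the exponential series has a coefficient of
degree n. *)
Lemma pser_exp_linear (a : K) n :
  pser_exp (pser_poly (a *: 'X)) n = a ^+ n / n`!%:R.
Proof.
rewrite /pser_exp big_ord_recr big1 => [|k _];
  rewrite /= pser_pow_poly /pser_poly exprZn coefZ coefXn.
  by rewrite add0r eqxx mulr1 mulrC.
by rewrite gtn_eqF ?mulr0.
Qed.

Lemma pser_mul_0 f g : pser_mul f g 0%N = f 0%N * g 0%N.
Proof. exact: big_ord1. Qed.

Lemma pser_inv_0 f : pser_inv f 0%N = (f 0%N)^-1.
Proof. by rewrite /pser_inv big_ord1 [pser_pow _ _ _]pser_oneE mulr1. Qed.

Lemma pser_mul_linear (a : K) g n :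
  pser_mul (pser_poly (a *: 'X)) g n = if n is j.+1 then a * g j else 0.
Proof.
have c i : pser_poly (a *: 'X) i = if i == 1%N then a else 0.
  by rewrite /pser_poly coefZ coefX; case: eqP; rewrite ?mulr1 ?mulr0.
rewrite /pser_mul; case: n => [|j]; first by rewrite big_ord1 c mul0r.
rewrite 2!big_ord_recl !c /= mul0r add0r subn1 big1 ?addr0 // => i _.
by rewrite c mul0r.
Qed.

End PowerSeries.

Section AsymSeries.
Variables (L : fieldType) (R : idomainType).
Variable phi : {rmorphism R -> {fraction {poly L}}}.
Variable w : int.
Implicit Types (f g : nat -> {fraction R}) (a c : nat -> L).

(** The substitution q |-> b^(-w) q turns f into a series with limit a; the
scaling is compatible with products, hence with the exponential. *)
Definition asym_series f (a : nat -> L) := forall n, asym phi (f n) (w *+ n) (a n).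

Lemma asym_pser_one : asym_series (pser_one _) (pser_one _).
Proof.
by move=> [|n]; rewrite !pser_oneE; [exact: asym1|exact: asym0].
Qed.

Lemma asym_pser_mul f g a c : asym_series f a -> asym_series g c ->
  asym_series (pser_mul f g) (pser_mul a c).
Proof.
move=> sf sg n; apply: asym_sum => i _.
have -> : w *+ n = w *+ i + w *+ (n - i) by rewrite -mulrnDr subnKC // -ltnS.
exact: asymM.
Qed.

Lemma asym_pser_pow f a k : asym_series f a ->
  asym_series (pser_pow f k) (pser_pow a k).
Proof.
move=> sf; elim: k => [|k IH]; first exact: asym_pser_one.
exact: asym_pser_mul.
Qed.

Lemma asym_pser_exp f a : (forall n, (0 < n)%N -> (n%:R : L) != 0) ->
  asym_series f a -> asym_series (pser_exp f) (pser_exp a).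
Proof.
move=> char0 sf n; apply: asym_sum => k _.
apply: asym_eq (asymM (asymV _ (asym_nat phi k`!)) (asym_pser_pow k sf n))
  _ _ _ => //.
  by rewrite char0 ?fact_gt0.
by rewrite oppr0 add0r.
Qed.

End AsymSeries.

Section Bounded.
Variables (L : fieldType) (R : idomainType).
Variable phi : {rmorphism R -> {fraction {poly L}}}.

(** The place is finite at x; the value of the limit is left unspecified, since it
matters only for the first coefficient of the argument of Exp. *)
Definition bounded (x : {fraction R}) := exists a, asym phi x 0 a.

Lemma boundedM x y : bounded x -> bounded y -> bounded (x * y).
Proof. by move=> [a xa] [c yc]; exists (a * c); exact: asymM xa yc. Qed.

Lemma boundedN x : bounded x -> bounded (- x).
Proof. by move=> [a xa]; exists (- a); exact: asymN. Qed.

Lemma boundedD x y : bounded x -> bounded y -> bounded (x + y).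
Proof. by move=> [a xa] [c yc]; exists (a + c); exact: asymD. Qed.

Lemma bounded0 : bounded 0.
Proof. by exists 0; exact: asym0. Qed.

Lemma bounded1 : bounded 1.
Proof. by exists 1; exact: asym1. Qed.

Definition bounded_series (f : nat -> {fraction R}) := forall n, bounded (f n).

Lemma bounded_pser_mul f g : bounded_series f -> bounded_series g ->
  bounded_series (pser_mul f g).
Proof.
move=> bf bg n; apply: (big_ind bounded bounded0 boundedD) => i _.
exact: boundedM.
Qed.

Lemma bounded_pser_inv f : bounded (f 0%N)^-1 -> bounded_series f ->
  bounded_series (pser_inv f).
Proof.
move=> b0 bf n; apply: boundedM => //.
have b1 : bounded_series (pser_one _).
  move=> m; rewrite pser_oneE; case: eqP => _; [exact: bounded1|exact: bounded0].
apply: (big_ind bounded bounded0 boundedD) => k _.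
move: (k : nat) => {}k; elim: k n => [|k IH] m; first exact: b1.
apply: bounded_pser_mul => // i; apply: boundedD => //.
exact/boundedN/boundedM.
Qed.

End Bounded.

(** * Leading term of the exponent *)

(** Also for t_4 = (t_1 t_2 t_3)^-1, whose coordinates along t_1, t_2, t_3 are
-1. *)
Lemma tw_neq0 N r i : tw N r i != 0.
Proof.
rewrite /tw; case: unlift => [j|].
  apply/eqP => /rowP /(_ (lshift (N + r) j)); rewrite !mxE !eqxx => /eqP.
  by rewrite oner_eq0.
rewrite oppr_eq0; apply/eqP => /rowP /(_ (lshift (N + r) ord0)).
rewrite summxE (bigD1 ord0) //= big1 => [|j /negPf j0].
  by rewrite !mxE !eqxx addr0 => /eqP; rewrite oner_eq0.
by rewrite mxE (inj_eq (@lshift_inj _ _)) eq_sym j0 andbF.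
Qed.

Lemma lambda_neq0 N r i : lambda N r i != 0.
Proof. by rewrite c1_eq0 tw_neq0. Qed.

Section Argument.
Variables N r : nat.
Hypothesis le_rN : (r <= N)%N.
Local Notation L := (ratfun (rkT N r)).
Local Notation l := (lambda N r).
Local Notation t := (tw N N).

Definition A_factor : ratfun (rkT N N) :=
  bracket (t 0 + t 1) * bracket (t 1 + t 2) * bracket (t 0 + t 2)
           / \prod_(i < 4) bracket (t i).

(** The residue at b = 0 of the d-th Adams operation of [A_factor]. For d = 1 it is
minus the integral of c_3(X), see [intX_c3X]. *)
Definition A_limit d : L :=
  ((l 0 + l 1) *+ d) * ((l 1 + l 2) *+ d) * ((l 0 + l 2) *+ d)
  / \prod_(i < 4) (l i *+ d).

(** The expansion of q^-1 / ([s^(1/2) q] [s^(-1/2) q]): its coefficients are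
Laurent polynomials in s^(1/4). *)
Definition q_factor :=
  pser_mul (pser_inv (qbracket (sw N))) (pser_inv (qbracket (- sw N))).

Lemma N_argumentE n : N_argument N n =
  if n is j.+1 then A_factor * bracket (sw N) * q_factor j else 0.
Proof. exact: pser_mul_linear. Qed.

Lemma qbracket_0 (x : weight N N) : qbracket x 0%N = - (ch_quarter x)^-1.
Proof.
rewrite /qbracket /pser_poly coefB coefZ coefX coefC mulr0 sub0r.
by rewrite ch_quarterN.
Qed.

Lemma qbracket_inv_0 (x : weight N N) :
  pser_inv (qbracket x) 0%N = - ch_quarter x.
Proof. by rewrite pser_inv_0 qbracket_0 invrN invrK. Qed.

Lemma q_factor_0 : q_factor 0%N = 1.
Proof.
transitivity (- ch_quarter (sw N) * - ch_quarter (- sw N)).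
  by rewrite [LHS]pser_mul_0; congr (_ * _); apply: qbracket_inv_0.
by rewrite mulrNN -ch_quarterD subrr ch_quarter0.
Qed.

Section Power.
Variables (d : nat) (phi : {rmorphism {mpoly rat[rkT N N]} -> {fraction {poly L}}}).
Hypothesis phiX : forall j, phi 'X_j = tofrac (curve r j) ^+ d.

Lemma bounded_quarter y : bounded phi (ch_quarter y).
Proof. by exists ((2 ^+ d) ^ surplus r y); apply: asym_quarter. Qed.

Lemma bounded_qbracket x : bounded_series phi (qbracket x).
Proof.
move=> m; rewrite /qbracket /pser_poly coefB coefZ coefX coefC.
by apply: boundedD; [case: eqP => _|apply: boundedN; case: eqP => _];
  rewrite ?mulr1 ?mulr0; do ?[exact: bounded_quarter | exact: bounded0].
Qed.

Lemma bounded_qbracket_inv x : bounded_series phi (pser_inv (qbracket x)).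
Proof.
apply: bounded_pser_inv; last exact: bounded_qbracket.
rewrite qbracket_0 invrN invrK; apply/boundedN/bounded_quarter.
Qed.

Lemma bounded_q_factor : bounded_series phi q_factor.
Proof. by apply: bounded_pser_mul; apply: bounded_qbracket_inv. Qed.

Lemma asym_bracket_tw i : asym phi (bracket (t i)) 1 (l i *+ d).
Proof.
have := asym_bracket le_rN phiX (tw N r i).
by rewrite (widen_tw le_rN) /shifted_c1 vdegree_tw addr0.
Qed.

Lemma asym_bracket_tw2 i j : asym phi (bracket (t i + t j)) 1 ((l i + l j) *+ d).
Proof.
have := asym_bracket le_rN phiX (tw N r i + tw N r j).
rewrite raddfD /= !(widen_tw le_rN) /shifted_c1 (raddfD (@vdegree N r)) /=.
by rewrite !vdegree_tw !addr0 c1D.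
Qed.

(** Three brackets that vanish at b = 0 over four of them: a simple pole. *)
Lemma asym_A : (0 < d)%N -> asym phi A_factor (- 1) (A_limit d).
Proof.
move=> d0; have nz : \prod_(i < 4) (l i *+ d) != 0.
  apply/prodf_neq0 => i _.
  by rewrite -mulr_natr mulf_neq0 ?lambda_neq0 // natr_eq0_ratfun -lt0n.
apply: asym_eq (asym_div nz (asymM (asymM (asym_bracket_tw2 0 1)
  (asym_bracket_tw2 1 2)) (asym_bracket_tw2 0 2))
  (asym_prod _ (fun i _ => asym_bracket_tw i))) _ _ _ => //.
by rewrite sumr_const card_ord.
Qed.

Lemma asym_bracket_sw : asym phi (bracket (sw N)) 0
  ((2 ^+ d) ^ ((N - r)%:Z + (N - r)%:Z) -
   (2 ^+ d) ^ (- ((N - r)%:Z + (N - r)%:Z))).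
Proof. by apply: asym_bracket_surplus => //; exact: surplus_sw. Qed.

(** The pole comes from [asym_A] alone, so that its order does not depend on the
power of q. *)
Lemma asym_N_argument j : (0 < d)%N ->
  exists a, asym phi (N_argument N j.+1) (- 1) a.
Proof.
move=> d0; rewrite N_argumentE; have [a qa] := bounded_q_factor j.
have h := asymM (asymM (asym_A d0) asym_bracket_sw) qa.
by eexists; apply: asym_eq h _ _ _.
Qed.

End Power.

Local Notation phi := (curve_map N r).

(** The Adams operation is absorbed in the curve, by raising it to the
d-th power. *)
Lemma adams_curve_map d : (0 < d)%N ->
  exists2 phid : {rmorphism {mpoly rat[rkT N N]} -> {fraction {poly L}}},
    (forall j, phid 'X_j = tofrac (curve r j) ^+ d) &
    (forall x k a, asym phid x k a -> asym phi (adams d x) k a).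
Proof.
move=> d0.
pose phid : {rmorphism {mpoly rat[rkT N N]} -> {fraction {poly L}}} :=
  phi \o comp_mpoly [tuple ('X_j : {mpoly rat[rkT N N]}) ^+ d | j < rkT N N].
exists phid => [j|x k a [y sy ly]].
  by rewrite /phid /= substX rmorphXn /= curve_mapX.
exists y; last exact: ly.
exact: (@specializes_adams _ _ phi phid d x y d0 (fun=> erefl) sy).
Qed.

End Argument.

(** * Comparison of the two sides *)

Section Limit.
Variables N r : nat.
Hypothesis lt_rN : (r < N)%N.
Local Notation L := (ratfun (rkT N r)).
Local Notation phi := (curve_map N r).
Let le_rN : (r <= N)%N := ltnW lt_rN.

(** The only part of the exponent that survives in the limit. For N - r >= 2 the
rescaling of q dominates even the pole of the coefficient of q. *)
Definition leading : L := if N == r.+1 then A_limit N r 1 * kappa N r else 0.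

(** The logarithm of [pser_Exp (N_argument N)]. *)
Definition Exp_exponent m : ratfun (rkT N N) :=
  \sum_(1 <= n < m.+1 | (n %| m)%N) (n%:R)^-1 * adams n (N_argument N (m %/ n)%N).

Lemma asym_adams_argument n j : (0 < n)%N ->
  exists a, asym phi ((n%:R)^-1 * adams n (N_argument N j.+1)) (- 1) a.
Proof.
move=> n0; have [phin phinX adamsP] := adams_curve_map N r n0.
have [a /adamsP xa] := asym_N_argument le_rN phinX j n0.
exists (n%:R^-1 * a); rewrite -[- 1]add0r; apply: asymM xa.
by rewrite -oppr0; apply: asymV (asym_nat _ _); rewrite natr_eq0_ratfun -lt0n.
Qed.

Lemma asym_argument_1 : N = r.+1 ->
  asym phi (adams 1 (N_argument N 1)) (- 1) (A_limit N r 1 * kappa N r).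
Proof.
move=> eN; have [phi1 phi1X adamsP] := adams_curve_map N r (ltn0Sn 0).
apply: adamsP; rewrite N_argumentE q_factor_0 mulr1.
apply: asym_eq (asymM (asym_A le_rN phi1X _) (asym_bracket_sw le_rN phi1X))
  _ _ _ => //.
congr (_ * _).
have -> : (N - r)%N = 1%N by rewrite eN subSnn.
by [].
Qed.

(** Every coefficient is O(b^-1), whereas the coefficient of q^m is rescaled by
b^((N - r)m). The limit is nonzero only for (N - r)m = 1, where the sum over the
divisors of m has a single term. *)
Lemma asym_Exp_exponent : asym_series phi (r%:Z - N%:Z) Exp_exponent
  (pser_poly (leading *: 'X)).
Proof.
move=> m; rewrite /pser_poly coefZ coefX.
case: (posnP m) => [->|m0].
  by rewrite mulr0 /Exp_exponent big_geq //; apply: asym0.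
have [/andP[/eqP m1 /eqP eN]|/negPf ne] := boolP ((m == 1%N) && (N == r.+1)).
  rewrite m1 mulr1 /leading ifT; last exact/eqP.
  rewrite /Exp_exponent big_mkcond big_nat1 dvd1n divn1 invr1 mul1r.
  by apply: asym_eq (asym_argument_1 eN) _ _ _; rewrite // mulr1n; lia.
have -> : leading * (m == 1%N)%:R = 0.
  by rewrite /leading; move: ne; case: eqP; case: eqP; rewrite ?mulr0 ?mul0r.
(* Outside the case m = N - r = 1 the poles have too small an order. *)
have lt : (r%:Z - N%:Z) *+ m < - 1.
  by move: ne m0 lt_rN; rewrite -mulr_natr; nia.
apply: asym_sum_small => n; rewrite mem_index_iota => /andP[n0 _] nm.
have [j ->] : exists j, (m %/ n)%N = j.+1.
  by exists (m %/ n).-1; rewrite prednK // divn_gt0 // dvdn_leq.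
have [a xa] := asym_adams_argument j n0.
exact: asym_weaken lt xa.
Qed.

(** Leading coefficients are unique, so that the two sides of the K-theoretic
identity have the same limit. *)
Lemma C_series_limit o n :
  N_series N o =1 pser_Exp (N_argument N) ->
  (-1) ^+ (r * n) * (- kappa N r) ^+ ((N - r) * n) * C_series r o n =
  leading ^+ n / n`!%:R.
Proof.
move=> HN; rewrite -pser_exp_linear.
have phiX j : phi 'X_j = tofrac (curve r j) ^+ 1 by rewrite curve_mapX.
apply: asym_inj (asym_N_series le_rN phiX o n) _; rewrite HN.
apply: asym_eq (asym_pser_exp _ asym_Exp_exponent n) _ _ _.
- by move=> k k0; rewrite natr_eq0_ratfun -lt0n.
- exact: erefl.
- by rewrite -mulr_natr; lia.
- exact: erefl.
Qed.

End Limit.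

(** * The cohomological exponent *)

Section Sign.
Variables N r : nat.
Local Notation l := (lambda N r).

(** The defining equation t_1 t_2 t_3 t_4 = 1 of T_0. *)
Lemma lambda3 : l ord_max = - (l 0 + l 1 + l 2).
Proof.
have e (i : 'I_4) (j : 'I_3) : i = widen_ord (leqnSn 3) j ->
    tw N r i = delta_mx 0 (lshift (N + r) j).
  move=> ->; rewrite /tw.
  rewrite (_ : widen_ord _ j = fintype.lift ord_max j) ?fintype.liftK //.
  by apply: val_inj; rewrite /= /bump leqNgt ltn_ord.
rewrite /lambda -!c1D -c1N; congr (c1 _); rewrite {1}/tw unlift_none.
have -> : tw N r 0 + tw N r 1 + tw N r 2 =
    \sum_(j < 3) delta_mx 0 (lshift (N + r) j).
  rewrite !big_ord_recr big_ord0 /= add0r.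
  by congr (_ + _ + _); apply/e/val_inj.
by [].
Qed.

Lemma big_ord4 (R : Type) (idx : R) (op : Monoid.law idx) (F : 'I_4 -> R) :
  \big[op/idx]_i F i = op (op (op (F 0) (F 1)) (F 2)) (F ord_max).
Proof.
rewrite !big_ord_recr big_ord0 /= Monoid.mul1m.
by congr (op (op (op (F _) (F _)) (F _)) _); apply: val_inj.
Qed.

Lemma prod_lambda : \prod_(i < 4) l i = - (l 0 * l 1 * l 2 * (l 0 + l 1 + l 2)).
Proof. by rewrite big_ord4 /= lambda3 mulrN. Qed.

(** With a fourth variable - (a + b + c), the elementary symmetric polynomial of
degree 3 factors. *)
Lemma e3_balanced (F : fieldType) (a b c : F) :
  b * c * - (a + b + c) + a * c * - (a + b + c) + a * b * - (a + b + c)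
  + a * b * c = - ((a + b) * (a + c) * (b + c)).
Proof. by ring. Qed.

(** A subset of cardinal 3 omits exactly one index. *)
Lemma mesym3E (K : comNzRingType) (v : 'I_4 -> K) :
  (mesym 4 K 3).@[v] = \sum_(i < 4) \prod_(j < 4 | j != i) v j.
Proof.
(* The default value ord0 is not reached: a set of 3 indices out of 4 has a
   nonempty complement. *)
rewrite raddf_sum /= (reindex_onto (fun i : 'I_4 => [set~ i])
  (fun h : {set 'I_4} => odflt ord0 [pick i | i \notin h])) /=; last first.
  move=> h /eqP h3; have : (0 < #|~: h|)%N by rewrite cardsCs setCK h3 card_ord.
  case/card_gt0P => i; rewrite inE => ih.
  case: pickP => [j jh|/(_ i)]; last by rewrite ih.
  apply/esym/eqP; rewrite eqEcard h3 cardsC1 card_ord /= andbT.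
  by apply/subsetP => k kh; rewrite !inE; apply: contraNneq jh => <-.
apply: eq_big => [i|i _].
  rewrite cardsC1 card_ord eqxx /=; case: pickP => [j|/(_ i)].
    by rewrite !inE negbK => /eqP ->; rewrite eqxx.
  by rewrite !inE eqxx.
rewrite rmorph_prod /=; apply: eq_big => [j|j _]; first by rewrite !inE.
exact: mevalXU.
Qed.

Lemma c3XE : c3X N r = - ((l 0 + l 1) * (l 0 + l 2) * (l 1 + l 2)).
Proof.
rewrite /c3X mesym3E big_ord4 ![\prod_(j < 4 | _) _]big_mkcond !big_ord4 /=.
by rewrite !mul1r !mulr1 lambda3 e3_balanced.
Qed.

Lemma intX_c3X : intX (c3X N r) = - A_limit N r 1.
Proof.
by rewrite /intX /A_limit c3XE mulNr; congr (- (_ / _)); rewrite mulrAC.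
Qed.

End Sign.

(** * Conclusion *)

Lemma C_series_sign N r (e : nat -> bool) (o : signs N) n :
  C_series r (fun n p => e n (+) o n p) n = (-1) ^+ e n * C_series r o n.
Proof.
rewrite /C_series mulr_sumr; apply: eq_bigr => p _.
by rewrite signr_addb mulrA.
Qed.

Lemma C_series_rank0 N (o : signs N) : C_series 0 o =1 euler_series o.
Proof.
move=> n; apply: eq_bigr => p _; congr (_ * _).
by rewrite /taut big_ord0 [chern _]vprod0 mul1r.
Qed.

(** Compares coefficients after the rescaling of q by k; the signs are gathered on
the side of c. *)
Lemma unscale (F : fieldType) (k a c u : F) m n : k != 0 ->
  (-1) ^+ m * (- k) ^+ n * c = (a * k) ^+ n / u ->
  (-1) ^+ m * c = (- a) ^+ n / u.
Proof.
move=> k0 e; apply: (mulfI (expf_neq0 n k0)).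
have -> : k ^+ n * ((- a) ^+ n / u) = (-1) ^+ n * ((a * k) ^+ n / u).
  by rewrite [(- a) ^+ n]exprNn exprMn !mulrA; congr (_ / _); ring.
by rewrite -e [(- k) ^+ n]exprNn -!mulrA mulrCA [RHS]mulrCA signrMK.
Qed.

(** Changing the orientation for n and r odd absorbs the sign (-1)^(rn), which
arises because -[x] appears in the K-theoretic class of V^[n]. *)
Lemma C_series_corank1 r (o : signs r.+1) :
  N_series r.+1 o =1 pser_Exp (N_argument r.+1) ->
  C_series r (fun n p => odd (n * r) (+) o n p) =1
  pser_exp (pser_poly (intX (c3X r.+1 r) *: 'X)).
Proof.
move=> HN n; rewrite C_series_sign signr_odd pser_exp_linear intX_c3X.
have := C_series_limit (ltnSn r) n HN; rewrite /leading eqxx subSnn mul1n => h.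
by rewrite mulnC; apply: unscale (kappa_neq0 _ _) h.
Qed.

(** Here V has rank 0, so that N - r = N >= 2 and the exponent tends to 0. *)
Lemma euler_series_trivial N (o : signs N) : (1 < N)%N ->
  N_series N o =1 pser_Exp (N_argument N) ->
  euler_series o =1 pser_one (ratfun (rkT N 0)).
Proof.
move=> N1 HN n; rewrite -C_series_rank0 pser_oneE.
have := C_series_limit (ltnW N1) n HN.
rewrite /leading (gtn_eqF N1) mul0n expr0 mul1r subn0.
case: n => [|n]; first by rewrite muln0 !expr0 mul1r fact0 divr1.
rewrite expr0n mul0r => /eqP; rewrite mulf_eq0 expf_eq0 oppr_eq0.
by rewrite (negPf (kappa_neq0 _ _)) andbF => /eqP.
Qed.

Theorem proposition5p9
  (oriented : forall N : nat, signs N -> Prop)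
  (oriented_rev : reversible oriented)
  (HN : forall N : nat, (0 < N)%N ->
     exists2 o : signs N, oriented N o &
       N_series N o =1 pser_Exp (N_argument N)) :
  (forall r : nat,
     exists2 o : signs r.+1, oriented r.+1 o &
       C_series r o =1 pser_exp (pser_poly (intX (c3X r.+1 r) *: 'X)))
  /\
  (forall N : nat, (0 < N)%N ->
     exists2 o : signs N, oriented N o &
       euler_series o =1
         if (N == 1)%N then
           let l i := lambda N 0 i in
           pser_exp (pser_poly
             (((l 0 + l 1) * (l 0 + l 2) * (l 1 + l 2)
               / (l 0 * l 1 * l 2 * (l 0 + l 1 + l 2))) *: 'X))
         else pser_one (ratfun (rkT N 0))).
Proof.
have part1 r : exists2 o : signs r.+1, oriented r.+1 o &
    C_series r o =1 pser_exp (pser_poly (intX (c3X r.+1 r) *: 'X)).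
  have [o or_o /C_series_corank1 Ho] := HN r.+1 (ltn0Sn r).
  by exists (fun n p => odd (n * r) (+) o n p) => //; apply: oriented_rev.
split=> // -[//|[|N]] _ /=.
  have [o or_o Ho] := part1 0; exists o => // n.
  rewrite -C_series_rank0 Ho; congr (pser_exp (pser_poly (_ *: _)) n).
  by rewrite /intX c3XE prod_lambda invrN mulrNN.
have [o or_o Ho] := HN N.+2 isT; exists o => //.
exact: euler_series_trivial.
Qed.
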